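(* Let $f\in\mathbb{Q}^2$ and $R=\{r^1,\dots,r^k\}\subset\mathbb{Q}^2$. There exists a finite subset $\Xi_1\subseteq\Delta_1$ such that for every $\gamma\in\Delta_1\setminus(\Xi_1\cup\Pi\cup\Delta_2)$, there exist $\gamma^1,\gamma^2\in\Delta$ such that $\gamma$ is a strict convex combination of $\gamma^1$ and $\gamma^2$, or there exists $\gamma'\in\Delta$ such that $\gamma$ is dominated by $\gamma'$. Moreover, the cardinality of $\Xi_1$ is bounded polynomially in the binary encoding sizes of $f,r^1,\dots,r^k$. Specifically, $\Xi_1$ is chosen as the set of all $\gamma(B)$ such that $B\in\mathbb{R}^{3\times2}$, $M(B)$ is a Type 1 triangle, there exist distinct points $p^{j_1},p^{j_2}\in\operatorname{vert}(B)\cap F_3(B)\cap P(B,R)$ (i.e. $F_3(B)$ has two corner rays), and one of the following holds, where $\Sigma_3$ denotes the maximal lattice-free split (a closed set) such that one facet of $\Sigma_3$ contains $F_3(B)$ and $\Sigma_3\cap\operatorname{int}(M(B))\ne\emptyset$: Case a. $f\notin\Sigma_3$. Case b. $f\in\Sigma_3$ and $P(B,R)\not\subset\Sigma_3$.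
   Context: For $B\in\mathbb{R}^{n\times 2}$ with rows $b^1,\dots,b^n$: $M(B)=\{x\in\mathbb{R}^2 : b^i\cdot(x-f)\le 1,\ i=1,\dots,n\}$ (so $f\in\operatorname{int}M(B)$), $F_i(B)=M(B)\cap\{x: b^i\cdot(x-f)=1\}$, $\operatorname{vert}(B)$ is the set of vertices of $M(B)$, $\psi_B(r)=\max_i b^i\cdot r$, $\gamma(B)=(\psi_B(r^j))_{j=1}^k$, and $P(B,R)=\{f+\tfrac{1}{\psi_B(r)}r : r\in R,\ \psi_B(r)>0\}$ is the set of ray intersections. A ray $r\in R$ is a corner ray of $M(B)$ if $f+\tfrac1{\psi_B(r)}r$ is a vertex of $M(B)$. The order of the rows of $B$ is arbitrary. A convex set in $\mathbb{R}^2$ is lattice-free if its interior contains no point of $\mathbb{Z}^2$; it is maximal lattice-free if inclusion-maximal among lattice-free convex sets. A maximal lattice-free split is a set $\{x: c\le a x_1+b x_2\le c+1\}$ with $a,b$ coprime integers, $c$ an integer. A Type 1 triangle is a maximal lattice-free triangle with integral vertices and exactly one integral point in the relative interior of each edge. A Type 2 triangle is a maximal lattice-free triangle with at least one fractional vertex $v$, exactly one integral point in the relative interior of each of the two edges incident to $v$, and at least two integral points on the third edge. $\Delta=\{\gamma(B): B\in\mathbb{R}^{3\times 2},\ M(B)\text{ lattice-free (not necessarily maximal)}\}$; $\Delta_i=\{\gamma(B): B\in\mathbb{R}^{3\times2},\ M(B)\text{ is a Type } i\text{ triangle}\}$ for $i=1,2$; $\Pi=\{\gamma(B): B\in\mathbb{R}^{3\times2},\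 M(B)\text{ is a maximal lattice-free split}\}$. A point $x$ is a strict convex combination of $y^1$ and $y^2$ if $y^1\ne y^2$ and $x=\tfrac12(y^1+y^2)$. A vector $a$ is dominated by $x$ if $a-x\in\mathbb{R}^k_+\setminus\{0\}$. ''Bounded polynomially'' means bounded by a fixed polynomial, independent of the data, in the total encoding size. *)

(* Defs.v *)
From HB Require Import structures.
From mathcomp Require Import all_boot all_order all_algebra finmap.
From mathcomp Require Import all_classical all_reals all_analysis.

Set Implicit Arguments.
Unset Strict Implicit.
Unset Printing Implicit Defensive.

Import Order.TTheory GRing.Theory Num.Theory.
Import numFieldNormedType.Exports.

Local Open Scope classical_set_scope.
Local Open Scope ring_scope.

(** Binary encoding sizes: [p / q] in lowest terms has size
    [1 + ceil (log2 (|p| + 1)) + ceil (log2 (q + 1))], and a vector of length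
    [n] has size [n] plus the sizes of its entries. *)

Definition size_rat (q : rat) : nat :=
  (1 + up_log 2 `|numq q|.+1 + up_log 2 `|denq q|.+1)%N.

Definition size_rV (n : nat) (v : 'rV[rat]_n) : nat :=
  (n + \sum_(i < n) size_rat (v ord0 i))%N.

Definition encoding_size (k : nat) (f : 'rV[rat]_2) (r : 'I_k -> 'rV[rat]_2) :
  nat := (size_rV f + \sum_(j < k) size_rV (r j))%N.

Section PlaneGeometry.
Variable R : realType.
Implicit Types (A S T : set 'rV[R]_2) (u v w x y : 'rV[R]_2).

Definition Z2 : set 'rV[R]_2 :=
  [set x | exists z : 'rV[int]_2, x = map_mx intr z].

Definition lattice_free A := interior A `&` Z2 = set0.

Definition maximal_lattice_free A :=
  [/\ @convex_set R 'rV[R]_2 A, lattice_free A &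
      forall A', @convex_set R 'rV[R]_2 A' -> lattice_free A' ->
        A `<=` A' -> A' = A].

Definition closed_segment u v : set 'rV[R]_2 :=
  [set x | exists t : R, [/\ 0 <= t, t <= 1 & x = (1 - t) *: u + t *: v]].

(* For [u != v], the relative interior of [closed_segment u v]. *)
Definition open_segment u v : set 'rV[R]_2 :=
  [set x | exists t : R, [/\ 0 < t, t < 1 & x = (1 - t) *: u + t *: v]].

Definition vertices A : set 'rV[R]_2 :=
  [set x | A x /\
    forall y z, A y -> A z -> y != z -> ~ open_segment y z x].

Definition is_triangle T u v w :=
  row_free (col_mx (v - u) (w - u)) /\
  T = [set x | exists a b c : R,
        [/\ [/\ 0 <= a, 0 <= b & 0 <= c], a + b + c = 1 &
            x = a *: u + b *: v + c *: w]].

Definition exactly_one_integral A := exists! z, (A `&` Z2) z.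

Definition at_least_two_integral A :=
  exists z1 z2, [/\ z1 != z2, (A `&` Z2) z1 & (A `&` Z2) z2].

Definition type1_triangle T :=
  maximal_lattice_free T /\
  exists u v w,
    [/\ is_triangle T u v w,
        [/\ Z2 u, Z2 v & Z2 w] &
        [/\ exactly_one_integral (open_segment u v),
            exactly_one_integral (open_segment v w) &
            exactly_one_integral (open_segment w u)]].

Definition type2_triangle T :=
  maximal_lattice_free T /\
  exists v u w,
    [/\ is_triangle T v u w,
        ~ Z2 v,
        exactly_one_integral (open_segment v u),
        exactly_one_integral (open_segment v w) &
        at_least_two_integral (closed_segment u w)].

Definition line (a b c : int) : set 'rV[R]_2 :=
  [set x | a%:~R * x ord0 0 + b%:~R * x ord0 1 = c%:~R].

Definition strip (a b c : int) : set 'rV[R]_2 :=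
  [set x | c%:~R <= a%:~R * x ord0 0 + b%:~R * x ord0 1 <= (c + 1)%:~R].

Definition maximal_lattice_free_split S :=
  exists a b c : int, coprimez a b /\ S = strip a b c.

Definition split_facet S (G : set 'rV[R]_2) :=
  exists a b c : int,
    [/\ coprimez a b, S = strip a b c &
        G = line a b c \/ G = line a b (c + 1)].

End PlaneGeometry.

Section Gauge.
Variables (R : realType) (n : nat) (f : 'rV[R]_2).
Implicit Types (B : 'M[R]_(n.+1, 2)) (i : 'I_n.+1).

Definition rowdot B i (x : 'rV[R]_2) : R := (row i B *m x^T) ord0 ord0.

Definition M B : set 'rV[R]_2 := [set x | forall i, rowdot B i (x - f) <= 1].

Definition F B i : set 'rV[R]_2 := M B `&` [set x | rowdot B i (x - f) = 1].

Definition vert B : set 'rV[R]_2 := vertices (M B).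

(* The default value of the iterated maximum is one of its terms. *)
Definition psi B (x : 'rV[R]_2) : R :=
  \big[Num.max/rowdot B ord0 x]_(i < n.+1) rowdot B i x.

Variables (k : nat) (r : 'I_k -> 'rV[R]_2).

Definition gamma B : 'rV[R]_k := \row_j psi B (r j).

Definition P B : set 'rV[R]_2 :=
  [set x | exists j, 0 < psi B (r j) /\ x = f + (psi B (r j))^-1 *: r j].

End Gauge.

Section Deltas.
Variables (R : realType) (f : 'rV[R]_2) (k : nat) (r : 'I_k -> 'rV[R]_2).
Implicit Types B : 'M[R]_(3, 2).

Definition Delta : set 'rV[R]_k :=
  [set g | exists B, lattice_free (M f B) /\ g = gamma r B].

Definition Delta1 : set 'rV[R]_k :=
  [set g | exists B, type1_triangle (M f B) /\ g = gamma r B].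

Definition Delta2 : set 'rV[R]_k :=
  [set g | exists B, type2_triangle (M f B) /\ g = gamma r B].

Definition Pi : set 'rV[R]_k :=
  [set g | exists B, maximal_lattice_free_split (M f B) /\ g = gamma r B].

(* Rows are numbered from 0: the facet F_3 of the text has index 2. *)
Definition i3 : 'I_3 := ord_max.

Definition is_Sigma3 B (S : set 'rV[R]_2) :=
  (exists G, split_facet S G /\ F f B i3 `<=` G) /\
  S `&` interior (M f B) !=set0.

Definition Xi1 : set 'rV[R]_k :=
  [set g | exists B,
    [/\ type1_triangle (M f B),
        (exists p1 p2, [/\ p1 != p2,
           (vert f B `&` F f B i3 `&` P f r B) p1 &
           (vert f B `&` F f B i3 `&` P f r B) p2]),
        (exists S, is_Sigma3 B S /\
           (~ S f \/ (S f /\ ~ (P f r B `<=` S)))) &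
        g = gamma r B]].

End Deltas.

Definition strict_convex_combination (R : realType) (k : nat)
    (x y1 y2 : 'rV[R]_k) :=
  y1 != y2 /\ x = 2^-1 *: (y1 + y2).

Definition dominated (R : realType) (k : nat) (a x : 'rV[R]_k) :=
  (forall j, 0 <= (a - x) ord0 j) /\ a - x != 0.

(* Main.v *)
Require Import Defs.
From HB Require Import structures.
From mathcomp Require Import all_boot all_order all_algebra finmap.
From mathcomp Require Import all_classical all_reals all_analysis.
From mathcomp Require Import unstable perm ring lra.

Set Implicit Arguments.
Unset Strict Implicit.
Unset Printing Implicit Defensive.

Import Order.TTheory GRing.Theory Num.Theory.
Import numFieldNormedType.Exports.

Local Open Scope classical_set_scope.
Local Open Scope ring_scope.

(** A Type 1 triangle with vertices V1, V2, V3 has the lattice basis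
    e1 = (V2 - V1) / 2, e2 = (V3 - V1) / 2 based at V1, and in the resulting
    coordinates (s, t) it is {s >= 0, t >= 0, s + t <= 2}.  Tilting the facet
    s + t = 2 about its midpoint (1, 1) keeps the triangle lattice-free, and
    tilting it so that V3 is cut off gives a Type 2 triangle.

    If some facet has no corner ray, then either a ray meets it away from its
    midpoint, and tilting in both directions exhibits gamma as a strict convex
    combination, or small tilts contain all ray intersections, so that gamma
    is dominated by, or equal to, a vector of Delta_2.  Otherwise some facet
    has two corner rays; as gamma is not in Xi_1, the ray intersections lie in
    the split {0 <= t <= 1}, hence in the triangle tilted so as to cut off the
    vertex outside of the split.

    For the cardinality, V1 and V2 are the first lattice points on their rays,
    so they are determined by the rays.  The third vertex is then known up to
    e2 -> e2 + a e1 with a an integer, and a = 0 as soon as a known point with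
    t >= 1 lies in the interior of the triangle: f in case a, and the point
    t = 1 of a ray leaving the split in case b.  Hence at most k^3 elements. *)

Definition dot (R : realType) (p x : 'rV[R]_2) : R :=
  p ord0 0 * x ord0 0 + p ord0 1 * x ord0 1.

Definition slack (R : realType) (n : nat) (f : 'rV[R]_2) (B : 'M[R]_(n.+1, 2))
  (i : 'I_n.+1) (x : 'rV[R]_2) : R := 1 - rowdot B i (x - f).

Section Slack.
Variables (R : realType) (n : nat) (f : 'rV[R]_2).
Implicit Types (B : 'M[R]_(n.+1, 2)) (i : 'I_n.+1) (p x y z : 'rV[R]_2).

Lemma rV2P x y : x ord0 0 = y ord0 0 -> x ord0 1 = y ord0 1 -> x = y.
Proof.
move=> h0 h1; apply/rowP => j; case: j => -[|[|//]] lt_j.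
- by rewrite -[Ordinal _]/(Ordinal lt_j) (_ : Ordinal lt_j = 0) //; apply: val_inj.
- by rewrite (_ : Ordinal lt_j = 1) //; apply: val_inj.
Qed.

Lemma dotDr p x y : dot p (x + y) = dot p x + dot p y.
Proof. by rewrite /dot !mxE; ring. Qed.

Lemma dotBr p x y : dot p (x - y) = dot p x - dot p y.
Proof. by rewrite /dot !mxE; ring. Qed.

Lemma dotNr p x : dot p (- x) = - dot p x.
Proof. by rewrite /dot !mxE; ring. Qed.

Lemma dotZr p a x : dot p (a *: x) = a * dot p x.
Proof. by rewrite /dot !mxE; ring. Qed.

Definition dotr := (dotDr, dotNr, dotZr).

Lemma rowdotE B i x : rowdot B i x = dot (row i B) x.
Proof.
rewrite /rowdot /dot mxE 2!big_ord_recl big_ord0 addr0 !mxE.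
by rewrite (_ : lift ord0 ord0 = 1) //; apply: val_inj.
Qed.

Lemma slack_affine B i x y z a :
  slack f B i (x + a *: (y - z)) =
  slack f B i x + a * (slack f B i y - slack f B i z).
Proof. by rewrite /slack !rowdotE !dotr; ring. Qed.

Lemma slack_f B i : slack f B i f = 1.
Proof. by rewrite /slack !rowdotE dotBr subrr subr0. Qed.

Lemma M_slack B x : M f B x <-> forall i, 0 <= slack f B i x.
Proof. by split=> h i; have := h i; rewrite /slack subr_ge0. Qed.

Lemma slack_continuous B i : continuous (slack f B i).
Proof.
move=> x; rewrite /slack.
have -> : (fun y => 1 - rowdot B i (y - f)) =
  (fun y : 'rV[R]_2 => (1 + rowdot B i f) -
     (row i B ord0 0 * y ord0 0 + row i B ord0 1 * y ord0 1)).
  by apply/funext => y; rewrite !rowdotE dotBr /dot; ring.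
have coord j : (y : 'rV[R]_2) ord0 j @[y --> x] --> x ord0 j.
  exact: coord_continuous.
exact: (cvgB (cvg_cst _) (cvgD (cvgMl_tmp (coord _)) (cvgMl_tmp (coord _)))).
Qed.

Lemma interior_extend (A : set 'rV[R]_2) x z :
  interior A x -> exists a : R, 0 < a /\ A (x + a *: (x - z)).
Proof.
move=> int_x.
have cont : (fun a : R => x + a *: (x - z)) @ (0 : R) --> x.
  suff : (fun a : R => x + a *: (x - z)) @ (0 : R) --> x + (0 : R) *: (x - z).
    by rewrite scale0r addr0.
  exact: (cvgD (cvg_cst _) (cvgZr_tmp cvg_id)).
have near_x := cvg_at_right_filter cont int_x.
near (0 : R)^'+ => a; exists a; split; first by [].
by near: a; exact: near_x.
Unshelve. all: by end_near.
Qed.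

Lemma interior_M B x :
  interior (M f B) x <-> forall i, 0 < slack f B i x.
Proof.
split=> [/(interior_extend f) [a [a_gt0 /M_slack h]] i|pos].
  by have := h i; rewrite slack_affine slack_f; nra.
suff : \forall y \near x, forall i, 0 < slack f B i y.
  by apply: filterS => y h; apply/M_slack => i; exact: ltW.
have near_i i : \forall y \near x, 0 < slack f B i y.
  exact: (cvgr_gt _ (@slack_continuous B i x)) (pos i).
exact: filter_forall near_i.
Qed.
End Slack.

Section Polygon.
Variables (R : realType) (n : nat) (f : 'rV[R]_2).
Implicit Types (B : 'M[R]_(n.+1, 2)) (i : 'I_n.+1) (p x y z : 'rV[R]_2).

Lemma M_convex B : @convex_set R 'rV[R]_2 (M f B).
Proof.
move=> x y k /set_mem /M_slack Mx /set_mem /M_slack My; apply/mem_set/M_slack => i.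
have -> : conv k x y = y + k%:num *: (x - y) :> 'rV[R]_2.
  rewrite /conv /=; apply: rV2P; rewrite !mxE /onem; ring.
rewrite slack_affine; have := Mx i; have := My i.
by have : 0 <= k%:num; [|have : k%:num <= 1 :> R; [|nra]].
Qed.

Lemma maximal_of_facet_points B :
  lattice_free (M f B) ->
  (forall i, exists y, [/\ Z2 y, slack f B i y = 0 &
     forall j, j != i -> 0 < slack f B j y]) ->
  maximal_lattice_free (M f B).
Proof.
move=> lfB pts; split=> //; first exact: M_convex.
move=> A cA lfA sMA; apply/seteqP; split=> // x Ax.
apply: contrapT => /M_slack /existsNP [i /negP]; rewrite -ltNge => sx_lt0.
have [y [Zy sy0 sy_gt0]] := pts i.
suff int_y : interior A y by have : (interior A `&` @Z2 R) y by []; rewrite lfA.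
have near_j j : \forall a \near (0 : R)^'+, 0 < slack f B j (y + a *: (y - x)).
  have [->|ji] := eqVneq j i.
    near=> a; rewrite slack_affine sy0 add0r sub0r mulr_gt0 ?oppr_gt0 //.
  have hy := sy_gt0 j ji.
  pose N := `|slack f B j x - slack f B j y| + 1.
  have N_gt0 : 0 < N by rewrite /N; have := normr_ge0 (slack f B j x - slack f B j y); lra.
  have near_lt : \forall a \near (0 : R)^'+, a < slack f B j y / N.
    by apply: nbhs_right_lt; rewrite divr_gt0.
  near=> a; rewrite slack_affine.
  have : a * N < slack f B j y by rewrite -ltr_pdivlMr //; near: a; exact: near_lt.
  have a0 : 0 < a by [].
  have := ler_norm (slack f B j x - slack f B j y); rewrite /N; nra.
have [a [a_gt0 ya]] : exists a : R, 0 < a /\ forall j, 0 < slack f B j (y + a *: (y - x)).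
  near (0 : R)^'+ => a; exists a; split; first by [].
  by near: a; exact: filter_forall near_j.
have cont : (fun y' => y' + a *: (y' - x)) @ y --> y + a *: (y - x).
  exact: (cvgD cvg_id (cvgZl_tmp (cvgB cvg_id (cvg_cst _)))).
have /interior_M int_ya := ya.
have near_y : \forall y' \near y, M f B (y' + a *: (y' - x)) := cont _ int_ya.
suff : \forall y' \near y, A y' by [].
near=> y'; have My' : M f B (y' + a *: (y' - x)) by near: y'; exact: near_y.
have k01 : 0 <= (1 + a)^-1 <= 1.
  by rewrite invr_ge0 invf_le1; lra.
pose k : {i01 R} := Itv01 (proj1 (andP k01)) (proj2 (andP k01)).
have -> : y' = conv k (y' + a *: (y' - x) : convex_lmodType 'rV[R]_2) x.
  rewrite /conv /=; apply: rV2P; rewrite !mxE /onem; field; lra.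
by apply/set_mem/cA; apply/mem_set => //; exact: sMA.
Unshelve. all: by end_near.
Qed.

Lemma open_segmentC x y : open_segment x y = open_segment y x.
Proof.
suff sub (u v : 'rV[R]_2) : open_segment u v `<=` open_segment v u by apply/seteqP; split.
move=> z [t [t0 t1 ->]]; by exists (1 - t); split; [lra|lra|rewrite subKr addrC].
Qed.

Lemma row_free_dual x y : row_free (col_mx x y) <->
  exists p q, [/\ dot p x = 1, dot p y = 0, dot q x = 0 & dot q y = 1].
Proof.
have sum2 (F : 'I_2 -> R) : \sum_i F i = F 0 + F 1.
  rewrite 2!big_ord_recl big_ord0 addr0.
  by rewrite (_ : lift ord0 ord0 = 1) //; apply: val_inj.
have cu j : col_mx x y (lshift 1 0) j = x 0 j by rewrite col_mxEu.
have cd j : col_mx x y (rshift 1 0) j = y 0 j by rewrite col_mxEd.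
have rs : rshift 1 0 = 1 :> 'I_(1 + 1) by apply: val_inj.
have ls : lshift 1 0 = 0 :> 'I_(1 + 1) by apply: val_inj.
split=> [/row_freeP [C hC]|[p [q [h1 h2 h3 h4]]]].
  exists (\row_j C j 0), (\row_j C j 1).
  have e (i j : 'I_(1 + 1)) : col_mx x y i 0 * C 0 j + col_mx x y i 1 * C 1 j = (i == j)%:R.
    by have /matrixP /(_ i j) := hC; rewrite [LHS]mxE sum2 => ->; rewrite mxE.
  have := (e 0 0, e 0 1, e 1 0, e 1 1).
  rewrite -[in col_mx x y 0]ls -[in col_mx x y 1]rs !cu !cd /dot !mxE /=.
  by move=> [[[e1 e2] e3] e4]; split; lra.
apply/row_freeP; exists (row_mx p^T q^T).
move: h1 h2 h3 h4; rewrite /dot => h1 h2 h3 h4.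
apply/matrixP => i j; rewrite [LHS]mxE sum2 [RHS]mxE.
by case: (split_ordP i) => k ->; case: (split_ordP j) => l ->;
   rewrite (ord1 k) (ord1 l) ?cu ?cd ?row_mxEl ?row_mxEr ![_^T _ _]mxE /= ?[_ * p _ _]mulrC
    ?[_ * q _ _]mulrC.
Qed.
End Polygon.

Section Triangles.
Variables (R : realType) (f : 'rV[R]_2).
Implicit Types (B : 'M[R]_(3, 2)) (i : 'I_3) (p x y z u v w : 'rV[R]_2).

Lemma slack_barycentric n (B : 'M[R]_(n.+1, 2)) (i : 'I_n.+1) a b c u v w :
  a + b + c = 1 ->
  slack f B i (a *: u + b *: v + c *: w) =
  a * slack f B i u + b * slack f B i v + c * slack f B i w.
Proof.
move=> abc; have -> : a = 1 - b - c by lra.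
by rewrite /slack !rowdotE !dotr; ring.
Qed.

Lemma is_triangle_rot T u v w : is_triangle T u v w -> is_triangle T v w u.
Proof.
case=> /row_free_dual [p [q [h1 h2 h3 h4]]] ->; split.
  apply/row_free_dual; exists q, (- (p + q)).
  move: h1 h2 h3 h4; rewrite /dot !mxE => h1 h2 h3 h4; split; lra.
apply/seteqP; split=> x [a [b [c [[a0 b0 c0] abc ->]]]].
  by exists b, c, a; split; [by split|lra|rewrite [RHS]addrC addrA].
by exists c, a, b; split; [by split|lra|rewrite -[RHS]addrA [RHS]addrC].
Qed.

Lemma triangle_edge_row B u v w : is_triangle (M f B) u v w ->
  exists i, [/\ slack f B i u = 0, slack f B i v = 0 & 0 < slack f B i w].
Proof.
move=> [/row_free_dual [p [q [h1 h2 h3 h4]]] T].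
have Mu : M f B u.
  rewrite T; exists 1, 0, 0; split; [by split|lra|].
  by rewrite !scale0r scale1r !addr0.
have Mv : M f B v.
  rewrite T; exists 0, 1, 0; split; [by split|lra|].
  by rewrite !scale0r scale1r addr0 add0r.
have Mw : M f B w.
  rewrite T; exists 0, 0, 1; split; [by split|lra|].
  by rewrite !scale0r scale1r !add0r.
pose y := u + 2^-1 *: (v - u).
have not_int : ~ interior (M f B) y.
  move=> /(interior_extend w) [e [e0]]; rewrite T => -[a [b [c [[a0 b0 c0] abc eq]]]].
  have : dot q (y + e *: (y - w) - u) = c.
    rewrite eq (_ : a = 1 - b - c); last lra.
    move: h3 h4; rewrite !dotr => h3 h4.
    have -> : dot q v = dot q u by lra.
    have -> : dot q w = 1 + dot q u by lra.
    ring.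
  rewrite /y; move: h3 h4; rewrite !dotr => h3 h4; nra.
have [i si] : exists i, slack f B i y <= 0.
  apply: contrapT => /forallNP h; apply: not_int; apply/interior_M => i.
  by rewrite ltNge; apply/negP/h.
exists i.
move/M_slack/(_ i): Mu => Mu; move/M_slack/(_ i): Mv => Mv; move/M_slack/(_ i): Mw => Mw.
rewrite slack_affine in si.
have su : slack f B i u = 0 by lra.
have sv : slack f B i v = 0 by lra.
split=> //; rewrite lt_neqAle Mw andbT; apply/eqP => sw.
have : M f B f by apply/M_slack => j; rewrite slack_f.
rewrite T => -[a [b [c [_ abc eq]]]].
have := slack_f f B i; rewrite {2}eq slack_barycentric // su sv -sw.
lra.
Qed.

Definition labelled_type1 B (V : 'I_3 -> 'rV[R]_2) :=
  [/\ lattice_free (M f B), (forall i, Z2 (V i)),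
      (forall i j, i != j -> exactly_one_integral (open_segment (V i) (V j))),
      (forall i j, i != j -> slack f B i (V j) = 0) &
      (forall i, 0 < slack f B i (V i))].

Lemma ord3P (Q : 'I_3 -> Prop) : Q 0 -> Q 1 -> Q 2 -> forall i, Q i.
Proof.
move=> q0 q1 q2; case=> -[|[|[|//]]] lt_i.
- by rewrite (_ : Ordinal lt_i = 0) //; apply: val_inj.
- by rewrite (_ : Ordinal lt_i = 1) //; apply: val_inj.
- by rewrite (_ : Ordinal lt_i = 2) //; apply: val_inj.
Qed.

Lemma type1_labelled B : type1_triangle (M f B) -> exists V, labelled_type1 B V.
Proof.
move=> [[_ lfB _] [u [v [w [tri [Zu Zv Zw] [Euv Evw Ewu]]]]]].
pose W (j : 'I_3) := if j == 0 then u else if j == 1 then v else w.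
have [ru [ru1 ru2 ru3]] := triangle_edge_row (is_triangle_rot tri).
have [rv [rv1 rv2 rv3]] := triangle_edge_row (is_triangle_rot (is_triangle_rot tri)).
have [rw [rw1 rw2 rw3]] := triangle_edge_row tri.
pose rho (j : 'I_3) := if j == 0 then ru else if j == 1 then rv else rw.
have W0 i j : i != j -> slack f B (rho i) (W j) = 0.
  by elim/ord3P: i; elim/ord3P: j; rewrite /rho /W /=.
have Wgt i : 0 < slack f B (rho i) (W i) by elim/ord3P: i; rewrite /rho /W /=.
have rho_inj : injective rho.
  move=> i j eq; apply/eqP/negPn/negP => ij.
  by have := Wgt j; rewrite -eq W0 // ltxx.
have WE i j : i != j -> exactly_one_integral (open_segment (W i) (W j)).
  by elim/ord3P: i; elim/ord3P: j; rewrite /W //= 1?open_segmentC //= 1?open_segmentC.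
have ZW i : Z2 (W i) by elim/ord3P: i; rewrite /W /=.
have rhoK := f_invF rho_inj.
exists (W \o invF rho_inj); split=> //=.
- by move=> i j ij; apply: WE; rewrite (inj_eq (can_inj rhoK)).
- by move=> i j ij; rewrite -{1}(rhoK i) W0 // (inj_eq (can_inj rhoK)).
- by move=> i; rewrite -{1}(rhoK i).
Qed.
End Triangles.

Section Chart.
Variables (R : realType) (f : 'rV[R]_2).
Implicit Types (B : 'M[R]_(3, 2)) (i : 'I_3) (p q x y z u v w : 'rV[R]_2).

Lemma Z2P x : Z2 x <-> x 0 0 \is a Num.int /\ x 0 1 \is a Num.int.
Proof.
split=> [[z ->]|[/intrP [a ha] /intrP [b hb]]].
  by rewrite !mxE; split; apply/intrP; eexists.
exists (\row_j if j == 0 then a else b).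
by apply: rV2P; rewrite !mxE.
Qed.

Lemma Z2D x y : Z2 x -> Z2 y -> Z2 (x + y).
Proof. by move=> /Z2P [? ?] /Z2P [? ?]; apply/Z2P; rewrite !mxE; split; apply: rpredD. Qed.

Lemma Z2B x y : Z2 x -> Z2 y -> Z2 (x - y).
Proof. by move=> /Z2P [? ?] /Z2P [? ?]; apply/Z2P; rewrite !mxE; split; apply: rpredB. Qed.

Lemma Z2Z (a : R) x : a \is a Num.int -> Z2 x -> Z2 (a *: x).
Proof. by move=> ha /Z2P [? ?]; apply/Z2P; rewrite !mxE; split; apply: rpredM. Qed.

(* The reflection of the segment in its midpoint preserves the lattice. *)
Lemma exactly_one_midpoint u v : Z2 u -> Z2 v ->
  exactly_one_integral (open_segment u v) ->
  Z2 (u + 2^-1 *: (v - u)) /\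
  forall z, Z2 z -> open_segment u v z -> z = u + 2^-1 *: (v - u).
Proof.
move=> Zu Zv [z0 [[Sz0 Zz0] uniq]].
have : z0 = u + v - z0.
  apply: uniq; split; last by apply: Z2B => //; exact: Z2D.
  have [t [t0 t1 eq]] := Sz0; exists (1 - t); split; [lra|lra|].
  by rewrite eq; apply: rV2P; rewrite !mxE; ring.
move=> eq; have mid : z0 = u + 2^-1 *: (v - u).
  apply: rV2P; move/rowP: eq => eq; [move: (eq 0)|move: (eq 1)]; rewrite !mxE; lra.
by rewrite -mid; split=> // z Zz Sz; rewrite -(uniq z).
Qed.

Lemma dual_decomposition p q e1 e2 x :
  dot p e1 = 1 -> dot p e2 = 0 -> dot q e1 = 0 -> dot q e2 = 1 ->
  x = dot p x *: e1 + dot q x *: e2.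
Proof.
rewrite /dot => h1 h2 h3 h4.
pose dp := p 0 0 * q 0 1 - p 0 1 * q 0 0.
pose de := e1 0 0 * e2 0 1 - e1 0 1 * e2 0 0.
have D : dp * de = 1.
  rewrite /dp /de.
  have := congr2 *%R h1 h4; have := congr2 *%R h2 h3; lra.
have e10 : e1 0 0 = de * q 0 1.
  have := congr1 (fun z : R => z * q 0 1) h1; have := congr1 (fun z : R => z * p 0 1) h3.
  move=> H1 H2.
  have : e1 0 0 * dp = q 0 1 by rewrite /dp; lra.
  by move=> <-; rewrite mulrCA [de * dp]mulrC D mulr1.
have e11 : e1 0 1 = - de * q 0 0.
  have := congr1 (fun z : R => z * q 0 0) h1; have := congr1 (fun z : R => z * p 0 0) h3.
  move=> H1 H2.
  have : e1 0 1 * dp = - q 0 0 by rewrite /dp; lra.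
  by move=> H; rewrite mulNr -mulrN -H mulrCA [de * dp]mulrC D mulr1.
have e20 : e2 0 0 = - de * p 0 1.
  have := congr1 (fun z : R => z * q 0 1) h2; have := congr1 (fun z : R => z * p 0 1) h4.
  move=> H1 H2.
  have : e2 0 0 * dp = - p 0 1 by rewrite /dp; lra.
  by move=> H; rewrite mulNr -mulrN -H mulrCA [de * dp]mulrC D mulr1.
have e21 : e2 0 1 = de * p 0 0.
  have := congr1 (fun z : R => z * q 0 0) h2; have := congr1 (fun z : R => z * p 0 0) h4.
  move=> H1 H2.
  have : e2 0 1 * dp = p 0 0 by rewrite /dp; lra.
  by move=> <-; rewrite mulrCA [de * dp]mulrC D mulr1.
apply: rV2P; rewrite !mxE ?e10 ?e11 ?e20 ?e21.
  rewrite -[LHS]mulr1 -D /dp; ring.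
rewrite -[LHS]mulr1 -D /dp; ring.
Qed.

Record chart B (i1 i2 i3 : 'I_3) u e1 e2 p q : Prop := Chart {
  dual11 : dot p e1 = 1;
  dual12 : dot p e2 = 0;
  dual21 : dot q e1 = 0;
  dual22 : dot q e2 = 1;
  chart_Z2_origin : Z2 u;
  chart_Z2_e1 : Z2 e1;
  chart_Z2_e2 : Z2 e2;
  chart_Z2 : forall x, Z2 x ->
    dot p (x - u) \is a Num.int /\ dot q (x - u) \is a Num.int;
  chart_f1 : 0 < dot p (f - u);
  chart_f2 : 0 < dot q (f - u);
  chart_f3 : dot p (f - u) + dot q (f - u) < 2;
  chart_slack1 : forall x, slack f B i1 x =
    (2 - dot p (x - u) - dot q (x - u)) / (2 - dot p (f - u) - dot q (f - u));
  chart_slack2 : forall x, slack f B i2 x = dot p (x - u) / dot p (f - u);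
  chart_slack3 : forall x, slack f B i3 x = dot q (x - u) / dot q (f - u)
}.

Lemma dual_lattice u e1 e2 p q :
  dot p e1 = 1 -> dot p e2 = 0 -> dot q e1 = 0 -> dot q e2 = 1 ->
  Z2 e1 -> Z2 e2 ->
  (forall x, Z2 x -> 0 < dot p (x - u) -> 0 < dot q (x - u) ->
     dot p (x - u) + dot q (x - u) < 2 -> False) ->
  (forall x, Z2 x -> 0 < dot p (x - u) < 1 -> dot q (x - u) = 0 -> False) ->
  (forall x, Z2 x -> dot p (x - u) = 0 -> 0 < dot q (x - u) < 1 -> False) ->
  forall x, Z2 x -> dot p (x - u) \is a Num.int /\ dot q (x - u) \is a Num.int.
Proof.
move=> h11 h12 h21 h22 Z1 Z2' no0 no1 no2 x Zx.
pose a := Num.floor (dot p (x - u)); pose b := Num.floor (dot q (x - u)).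
pose z := x - (a%:~R *: e1 + b%:~R *: e2).
have Zz : Z2 z by apply: Z2B => //; apply: Z2D; apply: Z2Z => //; apply: intr_int.
have pz : dot p (z - u) = dot p (x - u) - a%:~R.
  by rewrite /z !dotr h11 h12; ring.
have qz : dot q (z - u) = dot q (x - u) - b%:~R.
  by rewrite /z !dotr h21 h22; ring.
have /andP [a0 a1] := floor_itv (dot p (x - u)).
have /andP [b0 b1] := floor_itv (dot q (x - u)).
rewrite -/a -/b !intrD in a0 a1 b0 b1.
have [pz0|pz0] := eqVneq (dot p (z - u)) 0; have [qz0|qz0] := eqVneq (dot q (z - u)) 0.
- have -> : dot p (x - u) = a%:~R by lra.
  by have -> : dot q (x - u) = b%:~R by lra.
- have : 0 < dot q (z - u) by rewrite lt_neqAle eq_sym qz0; lra.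
  by move=> h; exfalso; apply: (no2 z) => //; lra.
- have : 0 < dot p (z - u) by rewrite lt_neqAle eq_sym pz0; lra.
  by move=> h; exfalso; apply: (no1 z) => //; lra.
- have : 0 < dot q (z - u) by rewrite lt_neqAle eq_sym qz0; lra.
  have : 0 < dot p (z - u) by rewrite lt_neqAle eq_sym pz0; lra.
  by move=> h h'; exfalso; apply: (no0 z) => //; lra.
Qed.

Lemma ord3_cases i1 i2 i3 i : uniq [:: i1; i2; i3] -> [\/ i = i1, i = i2 | i = i3].
Proof.
by elim/ord3P: i1; elim/ord3P: i2; elim/ord3P: i3; elim/ord3P: i => // _;
  first [by constructor 1|by constructor 2|by constructor 3].
Qed.

Lemma labelled_chart B V i1 i2 i3 : labelled_type1 f B V ->
  uniq [:: i1; i2; i3] ->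
  exists p q, chart B i1 i2 i3 (V i1)
    (2^-1 *: (V i2 - V i1)) (2^-1 *: (V i3 - V i1)) p q.
Proof.
move=> [lfB ZV EV sl0 sl_gt0] uniq123.
have /and3P [n12 n13 n23] : [&& i1 != i2, i1 != i3 & i2 != i3].
  by move: uniq123; rewrite /= !inE negb_or !andbT => /andP [/andP [-> ->] ->].
have all_i i := ord3_cases i uniq123.
set u := V i1; set e1 := 2^-1 *: (V i2 - u); set e2 := 2^-1 *: (V i3 - u).
pose c1 := slack f B i1 u; pose c2 := slack f B i2 (V i2); pose c3 := slack f B i3 (V i3).
have c1_gt0 : 0 < c1 by apply: sl_gt0.
have c2_gt0 : 0 < c2 by apply: sl_gt0.
have c3_gt0 : 0 < c3 by apply: sl_gt0.
have lin i x y : dot (- row i B) (x - y) = slack f B i x - slack f B i y.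
  by rewrite /slack !rowdotE /dot !mxE; ring.
have dotZl a p x : dot (a *: p) x = a * dot p x by rewrite /dot !mxE; ring.
pose p := (2 / c2) *: (- row i2 B); pose q := (2 / c3) *: (- row i3 B).
have n21 : i2 != i1 by rewrite eq_sym.
have n31 : i3 != i1 by rewrite eq_sym.
have n32 : i3 != i2 by rewrite eq_sym.
have sE x : dot p (x - u) = 2 / c2 * slack f B i2 x.
  by rewrite dotZl lin (sl0 i2 i1) // subr0.
have tE x : dot q (x - u) = 2 / c3 * slack f B i3 x.
  by rewrite dotZl lin (sl0 i3 i1) // subr0.
have h11 : dot p e1 = 1 by rewrite dotZr sE -/c2; field; lra.
have h12 : dot p e2 = 0 by rewrite dotZr sE sl0 // !mulr0.
have h21 : dot q e1 = 0 by rewrite dotZr tE sl0 // !mulr0.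
have h22 : dot q e2 = 1 by rewrite dotZr tE -/c3; field; lra.
have sl1 x : slack f B i1 x = c1 / 2 * (2 - dot p (x - u) - dot q (x - u)).
  have := dual_decomposition (x - u) h11 h12 h21 h22.
  move/(congr1 (fun z => z + u)); rewrite subrK => {1}->.
  set s := dot p _; set t := dot q _.
  have -> : s *: e1 + t *: e2 + u =
    (1 - s / 2 - t / 2) *: u + (s / 2) *: V i2 + (t / 2) *: V i3.
    by apply: rV2P; rewrite !mxE; field.
  rewrite slack_barycentric; last by ring.
  by rewrite (sl0 i1 i2) // (sl0 i1 i3) // -/c1; field.
have sf : dot p (f - u) = 2 / c2 by rewrite sE slack_f mulr1.
have tf : dot q (f - u) = 2 / c3 by rewrite tE slack_f mulr1.
have stf : 2 - dot p (f - u) - dot q (f - u) = 2 / c1.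
  have := sl1 f; rewrite slack_f; set d := 2 - _ - _ => h.
  have -> : d = 2 / c1 * (c1 / 2 * d) by field; lra.
  by rewrite -h mulr1.
have [Z1 uniq1] := exactly_one_midpoint (ZV i1) (ZV i2) (EV _ _ n12).
have [Z3 uniq2] := exactly_one_midpoint (ZV i1) (ZV i3) (EV _ _ n13).
rewrite -/u -/e1 in Z1 uniq1; rewrite -/u -/e2 in Z3 uniq2.
have Ze1 : Z2 e1 by have := Z2B Z1 (ZV i1); rewrite addrAC subrr add0r.
have Ze2 : Z2 e2 by have := Z2B Z3 (ZV i1); rewrite addrAC subrr add0r.
have c1i : 0 < 2 / c1 by rewrite divr_gt0.
have c2i : 0 < 2 / c2 by rewrite divr_gt0.
have c3i : 0 < 2 / c3 by rewrite divr_gt0.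
have Zu : Z2 u := ZV i1.
exists p, q; split=> //; rewrite ?sf ?tf //.
- apply: (dual_lattice h11 h12 h21 h22) => // x Zx.
  + move=> s0 t0 st.
    suff : interior (M f B) x.
      by move=> int_x; have : (interior (M f B) `&` @Z2 R) x by []; rewrite lfB.
    apply/interior_M => i; case: (all_i i) => ->.
    * by rewrite sl1 mulr_gt0 ?divr_gt0 //; lra.
    * by move: s0; rewrite sE pmulr_rgt0.
    * by move: t0; rewrite tE pmulr_rgt0.
  + move=> /andP [s0 s1] t0.
    have xE : x = u + dot p (x - u) *: e1.
      have := dual_decomposition (x - u) h11 h12 h21 h22.
      by rewrite t0 scale0r addr0 => <-; rewrite addrC subrK.
    have : x = u + e1.
      apply: uniq1 => //; exists (dot p (x - u) / 2); split; [lra|lra|].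
      by rewrite {1}xE; apply: rV2P; rewrite !mxE; field.
    by move=> xE'; move: s1; rewrite {1}xE' addrAC subrr add0r h11 ltxx.
  + move=> s0 /andP [t0 t1].
    have xE : x = u + dot q (x - u) *: e2.
      have := dual_decomposition (x - u) h11 h12 h21 h22.
      by rewrite s0 scale0r add0r => <-; rewrite addrC subrK.
    have : x = u + e2.
      apply: uniq2 => //; exists (dot q (x - u) / 2); split; [lra|lra|].
      by rewrite {1}xE; apply: rV2P; rewrite !mxE; field.
    by move=> xE'; move: t1; rewrite {1}xE' addrAC subrr add0r h22 ltxx.
- by move: stf; rewrite sf tf; lra.
- by move=> x; rewrite sl1 -sf -tf stf; field; lra.
- by move=> x; rewrite sE; field; lra.
- by move=> x; rewrite tE; field; lra.
Qed.
End Chart.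

Section IntegralReals.
Variable R : realType.
Implicit Types a b c : R.

Lemma int_ge1 a : a \is a Num.int -> 0 < a -> 1 <= a.
Proof. by move=> /intrP [m ->]; rewrite ltr0z ler1z gtz0_ge1. Qed.

Lemma int_between02 a : a \is a Num.int -> 0 < a -> a < 2 -> a = 1.
Proof.
move=> ha a0 a2; have a1 := int_ge1 ha a0.
have : 2 - a \is a Num.int by rewrite rpredB // -[2]/(2%:R) natr_int.
by move=> h; have := int_ge1 h; lra.
Qed.
Lemma int_eq0 a : a \is a Num.int -> -1 < a -> a < 1 -> a = 0.
Proof.
move=> aZ a1 a2; have a1Z : a + 1 \is a Num.int by rewrite rpredD // int_num1.
by have := int_between02 a1Z; lra.
Qed.

Lemma int_mul_eq1 a b : a \is a Num.int -> b \is a Num.int -> a * b = 1 ->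
  a = 1 \/ a = -1.
Proof.
move=> aZ bZ ab1.
have neg c : c \is a Num.int -> c < 0 -> c <= -1.
  by move=> cZ c0; have := int_ge1 (a := - c); rewrite rpredN cZ => /(_ isT); lra.
have [a0|a0|a0] := ltgtP a 0; last by move: ab1; rewrite a0 mul0r; lra.
- have a1 := neg _ aZ a0; have b0 : b < 0 by rewrite ltNge; apply/negP => b0; nra.
  by have b1 := neg _ bZ b0; right; nra.
- have a1 := int_ge1 aZ a0; have b0 : 0 < b by rewrite ltNge; apply/negP => b0; nra.
  by have b1 := int_ge1 bZ b0; left; nra.
Qed.
End IntegralReals.

Section Tilt.
Variables (R : realType) (f : 'rV[R]_2) (B : 'M[R]_(3, 2)).
Variables (i1 i2 i3 : 'I_3) (u e1 e2 p q : 'rV[R]_2).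
Hypothesis ch : chart f B i1 i2 i3 u e1 e2 p q.
Hypothesis uniq123 : uniq [:: i1; i2; i3].
Implicit Types (x y z : 'rV[R]_2).

Local Notation s x := (dot p (x - u)).
Local Notation t x := (dot q (x - u)).

Lemma chart_s a b : s (u + a *: e1 + b *: e2) = a.
Proof. by rewrite !dotr (dual11 ch) (dual12 ch); ring. Qed.

Lemma chart_t a b : t (u + a *: e1 + b *: e2) = b.
Proof. by rewrite !dotr (dual21 ch) (dual22 ch); ring. Qed.

Lemma chart_eq x : x = u + s x *: e1 + t x *: e2.
Proof.
have := dual_decomposition (x - u) (dual11 ch) (dual12 ch) (dual21 ch) (dual22 ch).
by move=> h; rewrite -addrA -h addrC subrK.
Qed.

Lemma chart_inj x y : s x = s y -> t x = t y -> x = y.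
Proof. by move=> hs ht; rewrite (chart_eq x) (chart_eq y) hs ht. Qed.

Lemma chart_lattice (a b : R) : a \is a Num.int -> b \is a Num.int ->
  Z2 (u + a *: e1 + b *: e2).
Proof.
move=> ha hb; apply: Z2D; last by apply: Z2Z => //; exact: chart_Z2_e2 ch.
by apply: Z2D; [exact: chart_Z2_origin ch|apply: Z2Z => //; exact: chart_Z2_e1 ch].
Qed.

Lemma chart_s_comb a x y : s ((1 - a) *: x + a *: y) = (1 - a) * s x + a * s y.
Proof. by rewrite !dotr; ring. Qed.

Lemma chart_t_comb a x y : t ((1 - a) *: x + a *: y) = (1 - a) * t x + a * t y.
Proof. by rewrite !dotr; ring. Qed.

Section TiltedTriangle.
Variables (B' : 'M[R]_(3, 2)) (al ka : R).
Hypothesis slack1 : forall x,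
  slack f B' i1 x = al * (2 - s x - t x) + ka * (s x - t x).
Hypothesis slack2 : forall x, slack f B' i2 x = s x / s f.
Hypothesis slack3 : forall x, slack f B' i3 x = t x / t f.
Hypothesis ka_gt : - al < ka.
Hypothesis ka_lt : ka < al.

Lemma tilted_M x : M f B' x <->
  [/\ 0 <= al * (2 - s x - t x) + ka * (s x - t x), 0 <= s x & 0 <= t x].
Proof.
have sf := chart_f1 ch; have tf := chart_f2 ch.
split=> [/M_slack h|[h1 h2 h3]].
  have := (h i1, h i2, h i3); rewrite slack1 slack2 slack3.
  by rewrite !pmulr_lge0 ?invr_gt0 // => -[[? ?] ?]; split.
apply/M_slack => i; case: (ord3_cases i uniq123) => ->; rewrite ?slack1 ?slack2 ?slack3 //.
  by rewrite divr_ge0 // ltW.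
by rewrite divr_ge0 // ltW.
Qed.

Lemma tilted_lattice_free : lattice_free (M f B').
Proof.
have [kg kl] := (ka_gt, ka_lt).
apply/seteqP; split=> // x [/interior_M h Zx].
have sf := chart_f1 ch; have tf := chart_f2 ch.
have [sZ tZ] := chart_Z2 ch Zx.
have := (h i1, h i2, h i3); rewrite slack1 slack2 slack3.
rewrite !pmulr_lgt0 ?invr_gt0 // => -[[h1 h2] h3].
have s1 := int_ge1 sZ h2; have t1 := int_ge1 tZ h3.
have : 0 <= (al - ka) * (s x - 1) by rewrite mulr_ge0 //; lra.
have : 0 <= (al + ka) * (t x - 1) by rewrite mulr_ge0 //; lra.
lra.
Qed.

Lemma tilted_type2 : 0 < ka -> type2_triangle (M f B').
Proof.
move=> ka_gt0.
have [kg kl] := (ka_gt, ka_lt).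
have sf := chart_f1 ch; have tf := chart_f2 ch.
have a0 : 0 < al by lra.
have a1 : 0 < al + ka by lra.
have a2 : 0 < al - ka by lra.
have sE a b := chart_s a b; have tE a b := chart_t a b.
have s0 : s u = 0 by rewrite subrr /dot !mxE !mulr0 addr0.
have t0 : t u = 0 by rewrite subrr /dot !mxE !mulr0 addr0.
have int1 : (1 : R) \is a Num.int by exact: int_num1.
have int0 : (0 : R) \is a Num.int by exact: int_num0.
split.
  apply: maximal_of_facet_points; first exact: tilted_lattice_free.
  move=> i.
  case: (ord3_cases i uniq123) => ->;
    [exists (u + 1 *: e1 + 1 *: e2)|exists (u + 0 *: e1 + 1 *: e2)
    |exists (u + 1 *: e1 + 0 *: e2)];
    (split; first exact: chart_lattice);
    rewrite ?slack1 ?slack2 ?slack3 ?sE ?tE; [lra| |by rewrite mul0r| |by rewrite mul0r| ];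
    move=> j; case: (ord3_cases j uniq123) => ->; rewrite ?eqxx // => _;
    rewrite ?slack1 ?slack2 ?slack3 ?sE ?tE ?divr_gt0 //; lra.
(* [v = (0, tau)] and [w = (om, 0)] are the two vertices moved by the tilt. *)
have [tau [tau' [tauK tauV tau_bd tau'_gt0]]] : exists tau tau' : R,
    [/\ tau * tau' = 1, tau' * (2 * al) = al + ka, 1 < tau < 2 & 0 < tau'].
  exists (2 * al / (al + ka)), ((al + ka) / (2 * al)); split; [by field; lra|by field; lra| |].
    by rewrite ltr_pdivlMr // ltr_pdivrMr //; lra.
  by rewrite divr_gt0 //; lra.
have [om [om' [omK omV om_gt2 om'_gt0]]] : exists om om' : R,
    [/\ om * om' = 1, om' * (2 * al) = al - ka, 2 < om & 0 < om'].
  exists (2 * al / (al - ka)), ((al - ka) / (2 * al)); split; [by field; lra|by field; lra| |].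
    by rewrite ltr_pdivlMr //; lra.
  by rewrite divr_gt0 //; lra.
have inv_sum : om' + tau' = 1.
  have h : (om' + tau' - 1) * (2 * al) = 0 by lra.
  by move/eqP: h; rewrite mulf_eq0 => /orP [] /eqP; lra.
have tau_al : tau * (al + ka) = 2 * al by rewrite -tauV mulrA tauK mul1r.
have om_al : om * (al - ka) = 2 * al by rewrite -omV mulrA omK mul1r.
pose v := u + 0 *: e1 + tau *: e2; pose w := u + om *: e1 + 0 *: e2.
have sv : s v = 0 by rewrite sE.
have tv : t v = tau by rewrite tE.
have sw : s w = om by rewrite sE.
have tw : t w = 0 by rewrite tE.
exists v, u, w; split.
- split.
    have dotZl a x y : dot (a *: x) y = a * dot x y by rewrite /dot !mxE; ring.
    have dotDl x y z : dot (x + y) z = dot x z + dot y z by rewrite /dot !mxE; ring.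
    have d1 x y : dot p (x - y) = s x - s y by rewrite !dotr; ring.
    have d2 x y : dot q (x - y) = t x - t y by rewrite !dotr; ring.
    apply/row_free_dual; exists (- tau' *: q + - om' *: p), (om' *: p).
    rewrite !dotDl !dotZl (d1 u v) (d1 w v) (d2 u v) (d2 w v) sv tv sw tw s0 t0.
    by split; lra.
  apply/seteqP; split=> x.
    move=> /tilted_M [h1 h2 h3].
    exists (t x * tau'), (1 - t x * tau' - s x * om'), (s x * om'); split.
    + split; [exact: mulr_ge0 h3 (ltW tau'_gt0)| |exact: mulr_ge0 h2 (ltW om'_gt0)].
      have al2 : 0 < 2 * al by lra.
      rewrite -(pmulr_lge0 _ al2).
      move: h1; set s := dot p _; set t := dot q _ => h1.
      by have := congr1 (fun z : R => t * z) tauV; have := congr1 (fun z : R => s * z) omV; lra.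
    + ring.
    + by rewrite {1}(chart_eq x) /v /w; set s := dot p _; set t := dot q _;
        apply: rV2P; rewrite !mxE;
        have := congr1 (fun z : R => t * z) tauK; have := congr1 (fun z : R => s * z) omK => H1 H2;
        have H3 (c : R) := congr1 (fun z : R => z * c) H1; have H4 (c : R) := congr1 (fun z : R => z * c) H2;
        [have := (H3 (e1 0 0), H4 (e2 0 0))|have := (H3 (e1 0 1), H4 (e2 0 1))];
        rewrite /= => -[]; lra.
  move=> [a [b [c [[h1 h2 h3] abc ->]]]].
  have bary r : dot r (a *: v + b *: u + c *: w - u) =
      a * dot r (v - u) + b * dot r (u - u) + c * dot r (w - u).
    by rewrite (_ : a = 1 - b - c); [rewrite !dotr; ring|lra].
  have sx : s (a *: v + b *: u + c *: w) = c * om by rewrite bary sv s0 sw; ring.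
  have tx : t (a *: v + b *: u + c *: w) = a * tau by rewrite bary tv t0 tw; ring.
  apply/tilted_M; rewrite sx tx; split; [|nra|nra].
  have -> : al * (2 - c * om - a * tau) + ka * (c * om - a * tau) =
      2 * al - c * (om * (al - ka)) - a * (tau * (al + ka)) by ring.
  rewrite om_al tau_al (_ : _ - _ - _ = b * (2 * al)); first by rewrite mulr_ge0 //; lra.
  by rewrite (_ : b = 1 - a - c); [ring|lra].
- by move=> /(chart_Z2 ch) [_ tZ]; have := int_between02 tZ; rewrite tv; lra.
- exists (u + 0 *: e1 + 1 *: e2); split.
    split; last exact: chart_lattice.
    exists (1 - tau'); split; [lra|lra|].
    by apply: chart_inj; rewrite ?chart_s_comb ?chart_t_comb ?sE ?tE ?sv ?tv ?s0 ?t0; lra.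
  move=> x [[a [a0' a1' xE]] Zx].
  have [sZ tZ] := chart_Z2 ch Zx.
  have sx : s x = 0 by rewrite xE chart_s_comb sv s0; ring.
  have tx : t x = (1 - a) * tau by rewrite xE chart_t_comb tv t0; ring.
  by apply: chart_inj; rewrite ?sE ?tE //; symmetry; apply: int_between02 => //; rewrite tx; nra.
- exists (u + 1 *: e1 + 1 *: e2); split.
    split; last exact: chart_lattice.
    exists om'; split; [lra|lra|].
    have om'E : 1 - om' = tau' by lra.
    by apply: chart_inj; rewrite ?chart_s_comb ?chart_t_comb ?sE ?tE ?sv ?tv ?sw ?tw om'E; lra.
  move=> x [[a [a0' a1' xE]] Zx].
  have [sZ tZ] := chart_Z2 ch Zx.
  have sx : s x = a * om by rewrite xE chart_s_comb sv sw; ring.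
  have tx : t x = (1 - a) * tau by rewrite xE chart_t_comb tv tw; ring.
  have sx1 : 1 <= s x by apply: int_ge1 => //; rewrite sx; nra.
  have tx1 : 1 <= t x by apply: int_ge1 => //; rewrite tx; nra.
  have eq : (al - ka) * (s x - 1) + (al + ka) * (t x - 1) = 0.
    rewrite sx tx; have -> : (al - ka) * (a * om - 1) + (al + ka) * ((1 - a) * tau - 1) =
      a * (om * (al - ka)) + (1 - a) * (tau * (al + ka)) - 2 * al by ring.
    by rewrite om_al tau_al; ring.
  have ge1 : 0 <= (al - ka) * (s x - 1) by rewrite mulr_ge0 //; lra.
  have ge2 : 0 <= (al + ka) * (t x - 1) by rewrite mulr_ge0 //; lra.
  have /eqP : (al - ka) * (s x - 1) = 0 by lra.
  have /eqP : (al + ka) * (t x - 1) = 0 by lra.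
  rewrite !mulf_eq0 (gt_eqF a1) (gt_eqF a2) /= !subr_eq0 => /eqP tx' /eqP sx'.
  by apply: chart_inj; rewrite ?sE ?tE.
- exists u, (u + 1 *: e1 + 0 *: e2); split.
  + apply/eqP => /(congr1 (fun x => s x)); rewrite s0 sE; lra.
  + split; last exact: chart_Z2_origin ch.
    by exists 0; split; [lra|lra|rewrite subr0 scale1r scale0r addr0].
  + split; last exact: chart_lattice.
    exists om'; split; [lra|lra|].
    by apply: chart_inj; rewrite ?chart_s_comb ?chart_t_comb ?sE ?tE ?s0 ?t0 ?sw ?tw; lra.
Qed.
End TiltedTriangle.

Let d0 : R := 2 - s f - t f.
Let m : R := t f - s f.

Definition tilt_direction : 'rV[R]_2 := (q - p) + (m / d0) *: (p + q).

Definition tilt (ka : R) : 'M[R]_(3, 2) :=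
  \matrix_(i, j) (B i j + (i == i1)%:R * (ka * tilt_direction ord0 j)).

Lemma rowdot_tilt ka i x :
  rowdot (tilt ka) i x = rowdot B i x + (i == i1)%:R * (ka * dot tilt_direction x).
Proof. by rewrite !rowdotE /dot !mxE; ring. Qed.

Lemma tilt_directionE x :
  dot tilt_direction (x - f) = t x - s x + (m / d0) * (s x + t x - 2).
Proof.
have d0_neq0 : d0 != 0 by have := chart_f3 ch; rewrite /d0 => h; apply/eqP; lra.
have -> : dot tilt_direction (x - f) =
  (t x - t f) - (s x - s f) + m / d0 * ((s x - s f) + (t x - t f)).
  by rewrite /dot !mxE; ring.
by rewrite /m; rewrite /d0 in d0_neq0 *; field.
Qed.

Section TiltSlack.
Variable ka : R.
Hypothesis ka_small : `|ka| <= 4^-1.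

Let al : R := (1 + ka * m) / d0.

Lemma tilt_slack1 x :
  slack f (tilt ka) i1 x = al * (2 - s x - t x) + ka * (s x - t x).
Proof.
have d0_neq0 : d0 != 0 by have := chart_f3 ch; rewrite /d0 => h; apply/eqP; lra.
rewrite /slack rowdot_tilt eqxx mul1r tilt_directionE opprD addrA -/(slack f B i1 x).
by rewrite (chart_slack1 ch) /al -/d0; field.
Qed.

Lemma tilt_slack2 x : slack f (tilt ka) i2 x = s x / s f.
Proof.
rewrite /slack rowdot_tilt; have -> : (i2 == i1) = false.
  by apply/eqP => e; move: uniq123; rewrite e /= !inE eqxx.
by rewrite mul0r addr0 -(chart_slack2 ch).
Qed.

Lemma tilt_slack3 x : slack f (tilt ka) i3 x = t x / t f.
Proof.
rewrite /slack rowdot_tilt; have -> : (i3 == i1) = false.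
  by apply/eqP => e; move: uniq123; rewrite e /= !inE eqxx orbT.
by rewrite mul0r addr0 -(chart_slack3 ch).
Qed.

Lemma tilt_bound : `|ka| < al.
Proof.
have := (chart_f1 ch, chart_f2 ch, chart_f3 ch); rewrite /al => -[[h1 h2] h3].
have d0_gt0 : 0 < d0 by rewrite /d0; lra.
rewrite ltr_pdivlMr //.
move: ka_small; rewrite ler_norml => /andP [k1 k2].
rewrite /d0 /m; have [k0|k0] := lerP 0 ka.
  have : 0 <= ka * t f by rewrite mulr_ge0 // ltW.
  by rewrite ger0_norm //; lra.
have : 0 <= - ka * s f by rewrite mulr_ge0 ?oppr_ge0 // ltW.
by rewrite ltr0_norm //; lra.
Qed.

Lemma tilt_lattice_free : lattice_free (M f (tilt ka)).
Proof.
have /andP [h1 h2] : - al < ka < al by rewrite -ltr_norml tilt_bound.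
exact: tilted_lattice_free tilt_slack1 tilt_slack2 tilt_slack3 h1 h2.
Qed.

Lemma tilt_type2 : 0 < ka -> type2_triangle (M f (tilt ka)).
Proof.
have /andP [h1 h2] : - al < ka < al by rewrite -ltr_norml tilt_bound.
exact: tilted_type2 tilt_slack1 tilt_slack2 tilt_slack3 h1 h2.
Qed.

Lemma tilt_M x : M f (tilt ka) x <->
  [/\ 0 <= al * (2 - s x - t x) + ka * (s x - t x), 0 <= s x & 0 <= t x].
Proof. exact: tilted_M tilt_slack1 tilt_slack2 tilt_slack3 x. Qed.
End TiltSlack.
End Tilt.

Section Gauge.
Variables (R : realType) (f : 'rV[R]_2) (n : nat).
Implicit Types (B : 'M[R]_(n.+1, 2)) (x y z : 'rV[R]_2).

Lemma rowdot_le_psi B i x : rowdot B i x <= psi B x.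
Proof. exact: (le_bigmax _ (fun j => rowdot B j x) i). Qed.

Lemma psi_attained B x : exists i, psi B x = rowdot B i x.
Proof.
rewrite /psi; elim/big_ind: _ => [|a b [i ->] [j ->]|i _]; first by exists ord0.
  by have [_|_] := leP (rowdot B i x) (rowdot B j x); [exists j|exists i].
by exists i.
Qed.

Lemma psi_eq B x c : (forall i, rowdot B i x <= c) -> (exists i, c = rowdot B i x) ->
  psi B x = c.
Proof.
move=> le_c [i ci]; apply/eqP; rewrite eq_le {2}ci rowdot_le_psi andbT.
by have [j ->] := psi_attained B x.
Qed.

Lemma psi0 B : psi B 0 = 0.
Proof.
have z i : rowdot B i 0 = 0 by rewrite rowdotE /dot !mxE; ring.
by apply: psi_eq; [move=> i; rewrite z|exists ord0; rewrite z].
Qed.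

Lemma slack_ray B i a x : slack f B i (f + a *: x) = 1 - a * rowdot B i x.
Proof. by rewrite /slack !rowdotE !dotr; ring. Qed.

Lemma ray_intersection_M B x : 0 < psi B x -> M f B (f + (psi B x)^-1 *: x).
Proof.
move=> px; apply/M_slack => i.
by rewrite slack_ray subr_ge0 mulrC ler_pdivrMr // mul1r rowdot_le_psi.
Qed.

Lemma psi_le_ray_intersection B B' x : 0 < psi B x ->
  M f B' (f + (psi B x)^-1 *: x) -> psi B' x <= psi B x.
Proof.
move=> px /M_slack h; have [i ->] := psi_attained B' x.
by have := h i; rewrite slack_ray subr_ge0 mulrC ler_pdivrMr // mul1r.
Qed.

End Gauge.

Section Rays.
Variables (R : realType) (f : 'rV[R]_2) (k : nat) (r : 'I_k -> 'rV[R]_2).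
Implicit Types (B : 'M[R]_(3, 2)) (x y z : 'rV[R]_2).

Lemma Delta2_or_dominated B B' :
  (forall j, r j != 0 -> 0 < psi B (r j)) ->
  type2_triangle (M f B') -> P f r B `<=` M f B' ->
  Delta2 f r (gamma r B) \/ exists g', Delta f r g' /\ dominated (gamma r B) g'.
Proof.
move=> psi_gt0 t2 sP.
have le_psi j : psi B' (r j) <= psi B (r j).
  have [->|rj] := eqVneq (r j) 0; first by rewrite !psi0.
  apply: psi_le_ray_intersection; first exact: psi_gt0.
  by apply: sP; exists j; split; first exact: psi_gt0.
have [eq|neq] := eqVneq (gamma r B) (gamma r B').
  by left; exists B'.
right; exists (gamma r B'); split; last split.
- by exists B'; split=> //; case: t2 => -[].
- by move=> j; rewrite !mxE subr_ge0.
- by rewrite subr_eq0.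
Qed.

Lemma near_mul_lt (c e : R) : 0 < e -> \forall a \near (0 : R)^'+, a * `|c| < e.
Proof.
move=> e0; have c0 : 0 < `|c| + 1 by rewrite ltr_wpDl.
have near_lt : \forall a \near (0 : R)^'+, a < e / (`|c| + 1).
  by apply: nbhs_right_lt; rewrite divr_gt0.
near=> a.
have : a * (`|c| + 1) < e by rewrite -ltr_pdivlMr //; near: a; exact: near_lt.
have : 0 < a by []. 
by rewrite mulrDr; lra.
Unshelve. all: by end_near.
Qed.

Section OneChart.
Variables (B : 'M[R]_(3, 2)) (i1 i2 i3 : 'I_3) (u e1 e2 p q : 'rV[R]_2).
Hypothesis ch : chart f B i1 i2 i3 u e1 e2 p q.
Hypothesis uniq123 : uniq [:: i1; i2; i3].

Local Notation s x := (dot p (x - u)).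
Local Notation t x := (dot q (x - u)).
Local Notation tilt := (tilt f B i1 u p q).

Lemma chart_M x : M f B x <-> [/\ s x + t x <= 2, 0 <= s x & 0 <= t x].
Proof.
have := (chart_f1 ch, chart_f2 ch, chart_f3 ch) => -[[h1 h2] h3].
have h3' : 0 < 2 - s f - t f by lra.
split=> [/M_slack h|[H1 H2 H3]].
  have := (h i1, h i2, h i3).
  rewrite (chart_slack1 ch) (chart_slack2 ch) (chart_slack3 ch).
  by rewrite !pmulr_lge0 ?invr_gt0 // => -[[? ?] ?]; split=> //; lra.
apply/M_slack => i; case: (ord3_cases i uniq123) => ->;
  rewrite ?(chart_slack1 ch) ?(chart_slack2 ch) ?(chart_slack3 ch);
  rewrite pmulr_lge0 ?invr_gt0 //; lra.
Qed.

Lemma chart_psi_gt0 x : x != 0 -> 0 < psi B x.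
Proof.
move=> x0; rewrite ltNge; apply/negP => px.
have := (chart_f1 ch, chart_f2 ch, chart_f3 ch) => -[[h1 h2] h3].
have h3' : 0 < 2 - s f - t f by lra.
have all_le i : 1 <= slack f B i (f + 1 *: x).
  by rewrite slack_ray mul1r; have := rowdot_le_psi B i x; lra.
have := (all_le i1, all_le i2, all_le i3).
rewrite (chart_slack1 ch) (chart_slack2 ch) (chart_slack3 ch).
rewrite !ler_pdivlMr // !mul1r scale1r.
have -> : s (f + x) = s f + dot p x by rewrite !dotr; ring.
have -> : t (f + x) = t f + dot q x by rewrite !dotr; ring.
move=> [[H1 H2] H3].
have px0 : dot p x = 0 by lra.
have qx0 : dot q x = 0 by lra.
move/eqP: x0; apply.
have := dual_decomposition x (dual11 ch) (dual12 ch) (dual21 ch) (dual22 ch).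
by rewrite px0 qx0 !scale0r addr0.
Qed.

Lemma P_sub_tilt_near :
  (forall x, P f r B x -> s x + t x = 2 -> s x = t x) ->
  \forall a \near (0 : R)^'+, P f r B `<=` M f (tilt a).
Proof.
move=> mid.
pose d0 := 2 - s f - t f; pose m := t f - s f.
have d0_gt0 : 0 < d0 by have := chart_f3 ch; rewrite /d0; lra.
have near_j j : \forall a \near (0 : R)^'+,
    0 < psi B (r j) -> M f (tilt a) (f + (psi B (r j))^-1 *: r j).
  have [pj|pj] := ltP 0 (psi B (r j)); last by near=> a.
  set x := f + _; have Px : P f r B x by exists j.
  have [st s0 t0] : [/\ s x + t x <= 2, 0 <= s x & 0 <= t x].
    by apply/chart_M; exact: ray_intersection_M.
  have [st2|st2] := eqVneq (s x + t x) 2.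
    near=> a => _.
    apply/(tilt_M ch uniq123); split=> //.
    have -> : s x = 1 by have := mid x Px st2; lra.
    have -> : t x = 1 by have := mid x Px st2; lra.
    by rewrite (_ : 2 - 1 - 1 = 0) ?subrr; [lra|lra].
  have e_gt0 : 0 < 2 - s x - t x by rewrite lt_neqAle in st2 *; lra.
  have near_lt := near_mul_lt (m * (2 - s x - t x) + (s x - t x) * d0) e_gt0.
  near=> a => _.
  have a0 : 0 < a by [].
  apply/(tilt_M ch uniq123); split=> //.
  rewrite -/d0 -/m -(pmulr_lge0 _ d0_gt0).
  have -> : ((1 + a * m) / d0 * (2 - s x - t x) + a * (s x - t x)) * d0 =
     (2 - s x - t x) + a * (m * (2 - s x - t x) + (s x - t x) * d0) by field; lra.
  have : a * `|m * (2 - s x - t x) + (s x - t x) * d0| < 2 - s x - t x.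
    by near: a; exact: near_lt.
  set c := m * _ + _ => lt_c.
  have : a * - c <= a * `|c| by rewrite ler_pM2l //; have := ler_norm (- c); rewrite normrN.
  by rewrite mulrN; lra.
have all_j : \forall a \near (0 : R)^'+, forall j,
    0 < psi B (r j) -> M f (tilt a) (f + (psi B (r j))^-1 *: r j).
  exact: filter_forall near_j.
near=> a.
have h : forall j, 0 < psi B (r j) -> M f (tilt a) (f + (psi B (r j))^-1 *: r j).
  by near: a; exact: all_j.
by move=> _ [j [pj ->]]; exact: h.
Unshelve. all: by end_near.
Qed.

Lemma tilt_convex_combination j0 :
  ~ P f r B (u + 2 *: e1) -> ~ P f r B (u + 2 *: e2) ->
  0 < psi B (r j0) ->
  s (f + (psi B (r j0))^-1 *: r j0) + t (f + (psi B (r j0))^-1 *: r j0) = 2 ->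
  s (f + (psi B (r j0))^-1 *: r j0) != t (f + (psi B (r j0))^-1 *: r j0) ->
  exists g1 g2, [/\ Delta f r g1, Delta f r g2 &
    strict_convex_combination (gamma r B) g1 g2].
Proof.
move=> no2 no3 pj0 st2 st_neq.
have := (chart_f1 ch, chart_f2 ch, chart_f3 ch) => -[[h1 h2] h3].
pose d := tilt_direction f u p q.
have rt a x i : rowdot (tilt a) i x = rowdot B i x + (i == i1)%:R * (a * dot d x).
  exact: rowdot_tilt.
have n21 : (i2 == i1) = false.
  by apply/eqP => e; move: uniq123; rewrite e /= !inE eqxx.
have n31 : (i3 == i1) = false.
  by apply/eqP => e; move: uniq123; rewrite e /= !inE eqxx orbT.
have rt1 a x : rowdot (tilt a) i1 x = rowdot B i1 x + a * dot d x.
  by rewrite rt eqxx mul1r.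
have rt2 a x : rowdot (tilt a) i2 x = rowdot B i2 x by rewrite rt n21 mul0r addr0.
have rt3 a x : rowdot (tilt a) i3 x = rowdot B i3 x by rewrite rt n31 mul0r addr0.
have psi3 (B' : 'M[R]_(3, 2)) x :
    psi B' x = Num.max (rowdot B' i1 x) (Num.max (rowdot B' i2 x) (rowdot B' i3 x)).
  apply: psi_eq.
    by move=> i; case: (ord3_cases i uniq123) => ->; rewrite !le_max lexx ?orbT.
  have [_|_] := leP (rowdot B' i1 x); last by exists i1.
  by have [_|_] := leP (rowdot B' i2 x); [exists i3|exists i2].
pose N x := Num.max (rowdot B i2 x) (rowdot B i3 x).
have psi_tilt a x : psi (tilt a) x = Num.max (rowdot B i1 x + a * dot d x) (N x).
  by rewrite psi3 rt1 rt2 rt3.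
have psiB x : psi B x = Num.max (rowdot B i1 x) (N x) by exact: psi3.
have bounds (a c e : R) : 0 < a -> a * `|c| < e -> (a * c < e) * (- a * c < e).
  move=> a0 ac.
  have : a * c <= a * `|c| by rewrite ler_pM2l // ler_norm.
  have : a * - c <= a * `|c| by rewrite ler_pM2l //; have := ler_norm (- c); rewrite normrN.
  by rewrite mulrN -mulNr => ? ?; split; lra.
have first_facet x : N x < rowdot B i1 x -> \forall a \near (0 : R)^'+,
    psi (tilt a) x = psi B x + a * dot d x /\ psi (tilt (- a)) x = psi B x - a * dot d x.
  move=> lt_N; have gap : 0 < rowdot B i1 x - N x by lra.
  have near_lt := near_mul_lt (dot d x) gap.
  near=> a.
  have a0 : 0 < a by [].
  have ac : a * `|dot d x| < rowdot B i1 x - N x by near: a; exact: near_lt.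
  have [b1 b2] := bounds _ _ _ a0 ac.
  rewrite !psi_tilt psiB (max_l (ltW lt_N)).
  have l1 : N x <= rowdot B i1 x + a * dot d x by lra.
  have l2 : N x <= rowdot B i1 x + - a * dot d x by lra.
  by rewrite (max_l l1) (max_l l2) mulNr.
have near_j j : \forall a \near (0 : R)^'+,
    psi (tilt a) (r j) + psi (tilt (- a)) (r j) = 2 * psi B (r j).
  have [->|rj] := eqVneq (r j) 0.
    by near=> a; rewrite !psi0; lra.
  have pj := chart_psi_gt0 rj.
  have [lt_N|lt_N|eq_N] := ltgtP (rowdot B i1 (r j)) (N (r j)).
  - have gap : 0 < N (r j) - rowdot B i1 (r j) by lra.
    have near_lt := near_mul_lt (dot d (r j)) gap.
    near=> a.
    have a0 : 0 < a by [].
    have ac : a * `|dot d (r j)| < N (r j) - rowdot B i1 (r j) by near: a; exact: near_lt.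
    have [b1 b2] := bounds _ _ _ a0 ac.
    have l1 : rowdot B i1 (r j) + a * dot d (r j) <= N (r j) by lra.
    have l2 : rowdot B i1 (r j) + - a * dot d (r j) <= N (r j) by lra.
    by rewrite !psi_tilt psiB (max_r l1) (max_r l2) (max_r (ltW lt_N)); ring.
  - have near_eq := first_facet _ lt_N.
    near=> a.
    have [-> ->] : psi (tilt a) (r j) = psi B (r j) + a * dot d (r j) /\
      psi (tilt (- a)) (r j) = psi B (r j) - a * dot d (r j) by near: a; exact: near_eq.
    by ring.
  - exfalso.
    set x := f + (psi B (r j))^-1 *: r j.
    have Px : P f r B x by exists j.
    have zero i : rowdot B i (r j) = psi B (r j) -> slack f B i x = 0.
      by move=> e; rewrite slack_ray e mulVf ?subrr // gt_eqF.
    have sl1 : slack f B i1 x = 0 by apply: zero; rewrite psiB eq_N maxxx.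
    have st : s x + t x = 2.
      move/eqP: sl1; rewrite (chart_slack1 ch) mulf_eq0 invr_eq0 => /orP [] /eqP; lra.
    have : N (r j) = rowdot B i2 (r j) \/ N (r j) = rowdot B i3 (r j).
      by rewrite /N; have [_|_] := leP (rowdot B i2 (r j)); [right|left].
    move=> [] eN.
    + have : slack f B i2 x = 0 by apply: zero; rewrite psiB eq_N maxxx.
      rewrite (chart_slack2 ch) => /eqP; rewrite mulf_eq0 invr_eq0 (gt_eqF h1) orbF => /eqP s0.
      apply: no3; rewrite (_ : u + 2 *: e2 = x) //.
      by rewrite [RHS](chart_eq ch) s0 scale0r addr0; congr (_ + _ *: _); lra.
    + have : slack f B i3 x = 0 by apply: zero; rewrite psiB eq_N maxxx.
      rewrite (chart_slack3 ch) => /eqP; rewrite mulf_eq0 invr_eq0 (gt_eqF h2) orbF => /eqP t0.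
      apply: no2; rewrite (_ : u + 2 *: e1 = x) //.
      by rewrite [RHS](chart_eq ch) t0 scale0r addr0; congr (_ + _ *: _); lra.
set x0 := f + (psi B (r j0))^-1 *: r j0 in st2 st_neq.
have sl1 : slack f B i1 x0 = 0 by rewrite (chart_slack1 ch) (_ : 2 - _ - _ = 0) ?mul0r //; lra.
have rd1 : rowdot B i1 (r j0) = psi B (r j0).
  move: sl1; rewrite slack_ray => /eqP; rewrite subr_eq0 => /eqP e.
  by rewrite -[RHS]mulr1 e mulrA divff ?mul1r // gt_eqF.
have Mx0 : M f B x0 by exact: ray_intersection_M.
have [_ sx0 tx0] := (chart_M x0).1 Mx0.
have Px0 : P f r B x0 by exists j0.
have lt_N0 : N (r j0) < rowdot B i1 (r j0).
  rewrite lt_neqAle; apply/andP; split; last by rewrite rd1 psiB le_max lexx orbT.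
  apply/eqP => eN; rewrite rd1 in eN.
  have zero i : rowdot B i (r j0) = psi B (r j0) -> slack f B i x0 = 0.
    by move=> e; rewrite slack_ray e mulVf ?subrr // gt_eqF.
  have : N (r j0) = rowdot B i2 (r j0) \/ N (r j0) = rowdot B i3 (r j0).
    by rewrite /N; have [_|_] := leP (rowdot B i2 (r j0)); [right|left].
  move=> [] eN'.
  + have : slack f B i2 x0 = 0 by apply: zero; rewrite -eN'.
    rewrite (chart_slack2 ch) => /eqP; rewrite mulf_eq0 invr_eq0 (gt_eqF h1) orbF => /eqP s0.
    apply: no3; rewrite (_ : u + 2 *: e2 = x0) //.
    by rewrite [RHS](chart_eq ch) s0 scale0r addr0; congr (_ + _ *: _); lra.
  + have : slack f B i3 x0 = 0 by apply: zero; rewrite -eN'.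
    rewrite (chart_slack3 ch) => /eqP; rewrite mulf_eq0 invr_eq0 (gt_eqF h2) orbF => /eqP t0.
    apply: no2; rewrite (_ : u + 2 *: e1 = x0) //.
    by rewrite [RHS](chart_eq ch) t0 scale0r addr0; congr (_ + _ *: _); lra.
have d_neq0 : dot d (r j0) != 0.
  have := tilt_directionE ch x0; rewrite (_ : s x0 + t x0 - 2 = 0); last lra.
  rewrite mulr0 addr0 /x0 addrAC subrr add0r dotZr -/x0 => e.
  apply/eqP => d0; move: e; rewrite d0 mulr0 => e.
  by move/eqP: st_neq; apply; lra.
have all_j : \forall a \near (0 : R)^'+, forall j,
    psi (tilt a) (r j) + psi (tilt (- a)) (r j) = 2 * psi B (r j).
  exact: filter_forall near_j.
have near_j0 := first_facet _ lt_N0.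
have small_a : \forall a \near (0 : R)^'+, a <= 4^-1 by apply: nbhs_right_le.
have [a [a0 a4 avg split0]] : exists a : R, [/\ 0 < a, a <= 4^-1,
    forall j, psi (tilt a) (r j) + psi (tilt (- a)) (r j) = 2 * psi B (r j) &
    psi (tilt a) (r j0) = psi B (r j0) + a * dot d (r j0) /\
    psi (tilt (- a)) (r j0) = psi B (r j0) - a * dot d (r j0)].
  near (0 : R)^'+ => a; exists a; split; first by [].
  - by near: a; exact: small_a.
  - by near: a; exact: all_j.
  - by near: a; exact: near_j0.
exists (gamma r (tilt a)), (gamma r (tilt (- a))); split.
- exists (tilt a); split=> //; apply: (tilt_lattice_free ch uniq123).
  by rewrite gtr0_norm.
- exists (tilt (- a)); split=> //; apply: (tilt_lattice_free ch uniq123).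
  by rewrite normrN gtr0_norm.
split.
  apply/eqP => /rowP /(_ j0); rewrite !mxE; case: split0 => -> -> e.
  have /eqP : a * dot d (r j0) = 0 by lra.
  by rewrite mulf_eq0 (gt_eqF a0) (negbTE d_neq0).
by apply/rowP => j; rewrite !mxE avg mulrA mulVf ?mul1r.
Unshelve. all: by end_near.
Qed.
End OneChart.
End Rays.

Section ChartFacts.
Variables (R : realType) (f : 'rV[R]_2) (B : 'M[R]_(3, 2)).
Variables (i1 i2 i3 : 'I_3) (u e1 e2 p q : 'rV[R]_2).
Hypothesis ch : chart f B i1 i2 i3 u e1 e2 p q.
Hypothesis uniq123 : uniq [:: i1; i2; i3].
Implicit Types (x y z : 'rV[R]_2).

Local Notation s x := (dot p (x - u)).
Local Notation t x := (dot q (x - u)).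

Lemma chart_interior x : interior (M f B) x <-> [/\ s x + t x < 2, 0 < s x & 0 < t x].
Proof.
have := (chart_f1 ch, chart_f2 ch, chart_f3 ch) => -[[h1 h2] h3].
have h3' : 0 < 2 - s f - t f by lra.
split=> [/interior_M h|[H1 H2 H3]].
  have := (h i1, h i2, h i3).
  rewrite (chart_slack1 ch) (chart_slack2 ch) (chart_slack3 ch).
  by rewrite !pmulr_lgt0 ?invr_gt0 // => -[[? ?] ?]; split=> //; lra.
apply/interior_M => i; case: (ord3_cases i uniq123) => ->;
  rewrite ?(chart_slack1 ch) ?(chart_slack2 ch) ?(chart_slack3 ch);
  rewrite pmulr_lgt0 ?invr_gt0 //; lra.
Qed.

Lemma chart_t_origin : t u = 0.
Proof. by rewrite subrr /dot !mxE !mulr0 addr0. Qed.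

Lemma chart_s_origin : s u = 0.
Proof. by rewrite subrr /dot !mxE !mulr0 addr0. Qed.

Lemma chart_origin_vert : vert f B u.
Proof.
have [s0 t0] := (chart_s_origin, chart_t_origin).
split; first by apply/(chart_M ch uniq123); rewrite s0 t0; split; lra.
move=> y z /(chart_M ch uniq123) [_ sy ty] /(chart_M ch uniq123) [_ sz tz] /eqP yz.
move=> [a [a0 a1 uE]].
have := chart_s_comb u p a y z; have := chart_t_comb u q a y z.
rewrite -uE s0 t0 => ht hs.
have zero b c : 0 <= b -> 0 <= c -> 0 = (1 - a) * b + a * c -> b = c.
  move=> b0 c0 h.
  have h1 : 0 <= (1 - a) * b by rewrite mulr_ge0 //; lra.
  have h2 : 0 <= a * c by rewrite mulr_ge0 // ltW.
  have /eqP : (1 - a) * b = 0 by lra.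
  have /eqP : a * c = 0 by lra.
  rewrite !mulf_eq0 (gt_eqF a0) /= => /eqP -> /orP [] /eqP; lra.
by apply: yz; apply: (chart_inj ch); apply: zero.
Qed.
End ChartFacts.

Section Sigma.
Variables (R : realType) (f : 'rV[R]_2) (B : 'M[R]_(3, 2)).
Variables (i1 i2 : 'I_3) (u e1 e2 p q : 'rV[R]_2).
Hypothesis ch : chart f B i1 i2 Defs.i3 u e1 e2 p q.
Hypothesis uniq123 : uniq [:: i1; i2; Defs.i3].
Implicit Types (x y z : 'rV[R]_2).

Local Notation s x := (dot p (x - u)).
Local Notation t x := (dot q (x - u)).

Lemma chart_F3 x : F f B Defs.i3 x <-> [/\ t x = 0, 0 <= s x & s x <= 2].
Proof.
have tf := chart_f2 ch.
have Fx : F f B Defs.i3 x <-> M f B x /\ slack f B Defs.i3 x = 0.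
  by split=> -[Mx e]; split=> //; move: e; rewrite /slack /=; lra.
rewrite Fx (chart_slack3 ch); split=> [[Mx /eqP]|[t0 s0 s2]].
  rewrite mulf_eq0 invr_eq0 (gt_eqF tf) orbF => /eqP t0.
  by have [? ? ?] := (chart_M ch uniq123 x).1 Mx; split=> //; lra.
rewrite t0 mul0r; split=> //; apply/(chart_M ch uniq123).
by rewrite t0; split=> //; lra.
Qed.

Lemma Sigma3_chart S : is_Sigma3 f B S -> forall x, S x <-> 0 <= t x <= 1.
Proof.
move=> [[G [[a [b [c [/coprimezP [[z0 z1] /= zE] SE GE]]]] FG]] [x0 [Sx0 /(chart_interior ch uniq123) [_ _ tx0]]]].
pose l : 'rV[R]_2 := \row_j (if j == 0 then a%:~R else b%:~R : R).
have dl x : a%:~R * x ord0 0 + b%:~R * x ord0 1 = dot l x by rewrite /dot !mxE.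
have Fu : F f B Defs.i3 u by apply/chart_F3; rewrite chart_t_origin chart_s_origin; split.
have Fv : F f B Defs.i3 (u + 1 *: e1 + 0 *: e2).
  by apply/chart_F3; rewrite (chart_t ch) (chart_s ch); split=> //; lra.
have le1 : dot l e1 = 0.
  have := (FG _ Fu, FG _ Fv); case: GE => ->; rewrite /line /= !dl !dotr => -[]; lra.
have lE x : dot l x = dot l u + t x * dot l e2.
  by rewrite {1}(chart_eq ch x) !dotr le1; ring.
pose z : 'rV[R]_2 := \row_j (if j == 0 then z0%:~R else z1%:~R).
have Zz : Z2 z by apply/Z2P; rewrite !mxE /=; split; exact: intr_int.
have lz : dot l z = 1.
  rewrite /dot !mxE /= -!intrM -intrD [X in X%:~R](_ : _ = 1) //.
  by rewrite -zE mulrC [_ * b]mulrC.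
have [_ tZ] := chart_Z2 ch (Z2D (chart_Z2_origin ch) Zz).
have l2Z : dot l e2 \is a Num.int.
  have /Z2P [h0 h1] := chart_Z2_e2 ch.
  by rewrite /dot !mxE /=; apply: rpredD; apply: rpredM => //; exact: intr_int.
have k1 : dot l e2 * t (u + z) = 1.
  by have := lE (u + z); rewrite dotDr lz; lra.
have Sx x : S x <-> c%:~R <= dot l x <= c%:~R + 1.
  by rewrite SE /strip /= dl intrD.
move/Sx: Sx0; rewrite lE => /andP [Sx1 Sx2].
have lu : dot l u = c%:~R \/ dot l u = c%:~R + 1.
  have := FG _ Fu; case: GE => ->; rewrite /line /= dl ?intrD; [by left|by right].
move=> x; rewrite Sx lE.
case: (int_mul_eq1 l2Z tZ k1) => k; rewrite k in Sx1 Sx2 *; case: lu => lu;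
  rewrite lu in Sx1 Sx2 *; by split=> /andP [? ?]; apply/andP; split; lra.
Qed.

Lemma Sigma3_exists : exists S, is_Sigma3 f B S.
Proof.
have [Zu Zu2] := (chart_Z2_origin ch, chart_Z2_e2 ch).
have qZ (x : 'rV[R]_2) : Z2 x -> dot q x \is a Num.int.
  move=> Zx; have [_] := chart_Z2 ch (Z2D Zu Zx).
  by rewrite addrAC subrr add0r.
have /qZ : Z2 (\row_j (if j == 0 then 1 else 0 : R)).
  by apply/Z2P; rewrite !mxE /=; split; [exact: int_num1|exact: int_num0].
have /qZ : Z2 (\row_j (if j == 0 then 0 else 1 : R)).
  by apply/Z2P; rewrite !mxE /=; split; [exact: int_num0|exact: int_num1].
rewrite /dot !mxE /= !mulr0 !mulr1 addr0 add0r => /intrP [b bE] /intrP [a aE].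
have /intrP [c cE] := qZ _ Zu.
have dq x : a%:~R * x ord0 0 + b%:~R * x ord0 1 = t x + c%:~R.
  by rewrite -cE dotBr /dot aE bE; ring.
exists (@strip R a b c); split.
  exists (@line R a b c); split.
    exists a, b, c; split=> //; last by left.
    have /Z2P [/intrP [z0 z0E] /intrP [z1 z1E]] := Zu2.
    apply/coprimezP; exists (z0, z1) => /=.
    have := dual22 ch; rewrite /dot aE bE z0E z1E -!intrM -intrD => /eqP.
    by rewrite -[1]/(1%:~R) eqr_int mulrC [b * _]mulrC => /eqP.
  by move=> x /chart_F3 [tx _ _]; rewrite /line /= dq tx add0r.
exists (u + 2^-1 *: e1 + 2^-1 *: e2); split.
  by rewrite /strip /= dq (chart_t ch) intrD; apply/andP; split; lra.
by apply/(chart_interior ch uniq123); rewrite (chart_s ch) (chart_t ch); split; lra.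
Qed.

Lemma facet3_vertex x : vert f B x -> F f B Defs.i3 x ->
  x = u \/ x = u + 2 *: e1.
Proof.
move=> [Mx vx] /chart_F3 [tx sx0 sx2].
have v0 : u + 2 *: e1 = u + 2 *: e1 + 0 *: e2 by rewrite scale0r addr0.
have [s0|s0] := eqVneq (s x) 0.
  by left; apply: (chart_inj ch); rewrite ?chart_s_origin ?chart_t_origin.
have [s2|s2] := eqVneq (s x) 2.
  by right; rewrite v0; apply: (chart_inj ch); rewrite ?(chart_s ch) ?(chart_t ch).
exfalso; apply: (vx u (u + 2 *: e1)).
- by apply/(chart_M ch uniq123); rewrite chart_s_origin chart_t_origin; split; lra.
- by rewrite v0; apply/(chart_M ch uniq123); rewrite (chart_s ch) (chart_t ch); split; lra.
- by apply/eqP => /(congr1 (fun y => s y)); rewrite v0 (chart_s ch) chart_s_origin; lra.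
exists (s x / 2); split.
- by have : 0 < s x; [rewrite lt_neqAle eq_sym s0|lra].
- by have : s x < 2; [rewrite lt_neqAle s2|lra].
- apply: (chart_inj ch); rewrite ?chart_s_comb ?chart_t_comb v0.
    by rewrite (chart_s ch) chart_s_origin; field.
  by rewrite (chart_t ch) chart_t_origin tx; ring.
Qed.
End Sigma.

Section Dichotomy.
Variables (R : realType) (f : 'rV[R]_2) (k : nat) (r : 'I_k -> 'rV[R]_2).
Implicit Types (B : 'M[R]_(3, 2)) (x y z : 'rV[R]_2).

Lemma ord3_complete (i : 'I_3) : exists i2 i3 : 'I_3, uniq [:: i; i2; i3].
Proof. by elim/ord3P: i; [exists 1, 2|exists 2, 0|exists 0, 1]. Qed.

Lemma rowdot_row_perm B (sg : 'S_3) i x : rowdot (row_perm sg B) i x = rowdot B (sg i) x.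
Proof. by rewrite !rowdotE /dot !mxE. Qed.

Lemma M_row_perm B (sg : 'S_3) : M f (row_perm sg B) = M f B.
Proof.
apply/seteqP; split=> x h i; last by rewrite rowdot_row_perm.
by have := h (sg^-1%g i); rewrite rowdot_row_perm permKV.
Qed.

Lemma psi_row_perm B (sg : 'S_3) x : psi (row_perm sg B) x = psi B x.
Proof.
apply: psi_eq => [i|]; first by rewrite rowdot_row_perm rowdot_le_psi.
by have [i ->] := psi_attained B x; exists (sg^-1%g i); rewrite rowdot_row_perm permKV.
Qed.

Lemma gamma_row_perm B (sg : 'S_3) : gamma r (row_perm sg B) = gamma r B.
Proof. by apply/rowP => j; rewrite !mxE psi_row_perm. Qed.

Lemma P_row_perm B (sg : 'S_3) : P f r (row_perm sg B) = P f r B.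
Proof. by apply/seteqP; split=> x [j]; rewrite ?psi_row_perm => h; exists j; rewrite ?psi_row_perm. Qed.

Lemma labelled_row_perm B V (sg : 'S_3) : labelled_type1 f B V ->
  labelled_type1 f (row_perm sg B) (V \o sg).
Proof.
move=> [lf ZV EV s0 s1]; split=> /=.
- by rewrite M_row_perm.
- by move=> i; exact: ZV.
- by move=> i j ij; apply: EV; rewrite (inj_eq perm_inj).
- by move=> i j ij; rewrite /slack rowdot_row_perm; apply: s0; rewrite (inj_eq perm_inj).
- by move=> i; rewrite /slack rowdot_row_perm; exact: s1.
Qed.

Lemma labelled_vert B V i : labelled_type1 f B V -> vert f B (V i).
Proof.
move=> lab; have [i2 [i3 un]] := ord3_complete i.
have [p [q ch]] := labelled_chart lab un.
exact: chart_origin_vert ch un.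
Qed.

Let improvable g :=
  (exists g1 g2, [/\ Delta f r g1, Delta f r g2 & strict_convex_combination g g1 g2]) \/
  (exists g', Delta f r g' /\ dominated g g').

Lemma free_facet B V i1 : labelled_type1 f B V ->
  (forall i, i != i1 -> ~ P f r B (V i)) -> ~ Delta2 f r (gamma r B) ->
  improvable (gamma r B).
Proof.
move=> lab free notD2; have [i2 [i3 un]] := ord3_complete i1.
have [p [q ch]] := labelled_chart lab un.
set u := V i1 in ch; set e1 := _ *: _ in ch; set e2 := 2^-1 *: (V i3 - u) in ch.
have /and3P [n12 n13 n23] : [&& i1 != i2, i1 != i3 & i2 != i3].
  by move: un; rewrite /= !inE negb_or !andbT => /andP [/andP [-> ->] ->].
have [all_mid|] := pselect (forall x, P f r B x ->
    dot p (x - u) + dot q (x - u) = 2 -> dot p (x - u) = dot q (x - u)).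
  have near_sub := P_sub_tilt_near ch un all_mid.
  have [a [a0 a4 sub]] : exists a : R, [/\ 0 < a, a <= 4^-1 & P f r B `<=` M f (tilt f B i1 u p q a)].
    have small_a : \forall a \near (0 : R)^'+, a <= 4^-1 by apply: nbhs_right_le.
    near (0 : R)^'+ => a; exists a; split; first by [].
    - by near: a; exact: small_a.
    - by near: a; exact: near_sub.
  have a4' : `|a| <= 4^-1 by rewrite gtr0_norm.
  have psi_gt0 j : r j != 0 -> 0 < psi B (r j) by exact: (chart_psi_gt0 ch).
  have := Delta2_or_dominated psi_gt0 (tilt_type2 ch un a4' a0) sub.
  by case=> // dom; right.
move=> /existsNP [x /not_implyP [[j [pj xE]] /not_implyP [st neq]]]; left.
have v2 : u + 2 *: e1 = V i2 by rewrite scalerA mulfV // scale1r addrC subrK.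
have v3 : u + 2 *: e2 = V i3 by rewrite scalerA mulfV // scale1r addrC subrK.
apply: (tilt_convex_combination ch un (j0 := j)); rewrite -?xE //.
- by rewrite v2; apply: free; rewrite eq_sym.
- by rewrite v3; apply: free; rewrite eq_sym.
- exact/eqP.
Unshelve. all: by end_near.
Qed.

Lemma corner_facet B V : type1_triangle (M f B) -> labelled_type1 f B V ->
  P f r B (V 0) -> P f r B (V 1) -> ~ Xi1 f r (gamma r B) ->
  ~ Delta2 f r (gamma r B) -> improvable (gamma r B).
Proof.
move=> t1 lab P0 P1 notXi notD2.
have un : uniq [:: 0; 1; Defs.i3] by [].
have [p [q ch]] := labelled_chart lab un.
set u := V 0 in ch; set e1 := _ *: _ in ch; set e2 := 2^-1 *: (V Defs.i3 - u) in ch.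
have v1 : V 1 = u + 1 *: (2 *: e1) + 0 *: e2.
  by rewrite scale1r scale0r addr0 scalerA mulfV // scale1r addrC subrK.
have [S SS] := Sigma3_exists ch un.
have SE := Sigma3_chart ch un SS.
have v1' : V 1 = u + 2 *: e1 + 0 *: e2 by rewrite v1 scale1r.
have Psub : P f r B `<=` S.
  apply: contrapT => nPS; apply: notXi; exists B; split=> //; last first.
    exists S; split=> //; have [Sf|nSf] := pselect (S f); first by right.
    by left.
  exists (V 0), (V 1); split.
  - apply/eqP => /(congr1 (fun x => dot p (x - u))).
    by rewrite v1' (chart_s ch) (chart_s_origin u p); lra.
  - split=> //; split; first exact: labelled_vert.
    by apply/(chart_F3 ch un); rewrite chart_s_origin chart_t_origin; split.
  - split=> //; split; first exact: labelled_vert.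
    by apply/(chart_F3 ch un); rewrite v1' (chart_s ch) (chart_t ch); split=> //; lra.
have k0 : (0 : R) < 8^-1 by lra.
have k4 : `|8^-1 : R| <= 4^-1 by rewrite gtr0_norm //; lra.
have psi_gt0 j : r j != 0 -> 0 < psi B (r j) by exact: (chart_psi_gt0 ch).
have sub : P f r B `<=` M f (tilt f B 0 u p q 8^-1).
  move=> x Px; have /SE /andP [_ t1x] := Psub x Px.
  have Mx : M f B x by case: Px => j [pj ->]; exact: ray_intersection_M.
  have [st s0 t0] := (chart_M ch un x).1 Mx.
  apply/(tilt_M ch un); split=> //.
  have := tilt_bound ch k4; rewrite gtr0_norm //; set al := _ / _ => bound.
  set s := dot p _ in st s0 *; set t := dot q _ in st t0 t1x *.
  have : 0 <= (al - 8^-1) * (2 - s - t) by rewrite mulr_ge0 //; lra.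
  lra.
have := Delta2_or_dominated psi_gt0 (tilt_type2 ch un k4 k0) sub.
by case=> // dom; right.
Qed.

Lemma type1_dichotomy B : type1_triangle (M f B) -> ~ Xi1 f r (gamma r B) ->
  ~ Delta2 f r (gamma r B) -> improvable (gamma r B).
Proof.
move=> t1 notXi notD2; have [V lab] := type1_labelled t1.
have [[i1 free]|] := pselect (exists i1, forall i, i != i1 -> ~ P f r B (V i)).
  exact: free_facet lab free notD2.
move=> notfree.
have [i0 hit] : exists i0, forall i, i != i0 -> P f r B (V i).
  have two i : exists i', i' != i /\ P f r B (V i').
    apply: contrapT => h; apply: notfree; exists i => j ji Pj.
    by apply: h; exists j.
  have [i [_ Pi]] := two 0; have [j [ji Pj]] := two i.
  have [l un] : exists l, uniq [:: l; i; j].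
    by move: ji; elim/ord3P: i {Pi}; elim/ord3P: j {Pj} => // _;
      first [by exists 0|by exists 1|by exists 2].
  exists l => m ml; case: (ord3_cases m un) => e; rewrite e // in ml *.
  by rewrite eqxx in ml.
pose sg : 'S_3 := tperm i0 Defs.i3.
have hit_sg i : i != Defs.i3 -> P f r B (V (sg i)).
  by move=> i3; apply: hit; rewrite -(tpermR i0 Defs.i3) (inj_eq perm_inj).
rewrite -(gamma_row_perm B sg) in notXi notD2 *.
apply: (corner_facet (V := V \o sg)) => //.
- by rewrite M_row_perm.
- exact: labelled_row_perm.
- by rewrite P_row_perm; apply: hit_sg.
- by rewrite P_row_perm; apply: hit_sg.
Qed.
End Dichotomy.

Section Counting.
Variables (R : realType) (f : 'rV[R]_2) (k : nat) (r : 'I_k -> 'rV[R]_2).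
Implicit Types (B : 'M[R]_(3, 2)) (x y z u p q : 'rV[R]_2).

Lemma interior_ray B x (a b : R) : M f B (f + b *: x) -> 0 <= a -> a < b ->
  interior (M f B) (f + a *: x).
Proof.
move=> /M_slack h a0 ab; apply/interior_M => i; have := h i; rewrite !slack_ray.
have [x0|x0] := lerP (rowdot B i x) 0.
  have : 0 <= a * - rowdot B i x by rewrite mulr_ge0 //; lra.
  lra.
have : a * rowdot B i x < b * rowdot B i x by rewrite ltr_pM2r.
lra.
Qed.

Lemma lattice_on_ray B B' x (a a' : R) :
  lattice_free (M f B) -> lattice_free (M f B') -> 0 < a -> 0 < a' ->
  M f B (f + a *: x) -> M f B' (f + a' *: x) ->
  Z2 (f + a *: x) -> Z2 (f + a' *: x) -> a = a'.
Proof.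
move=> lfB lfB' a0 a'0 Ma Ma' Za Za'; apply/eqP; rewrite eq_le !leNgt.
apply/andP; split; apply/negP => lt.
  have : (interior (M f B) `&` @Z2 R) (f + a' *: x).
    by split=> //; apply: interior_ray Ma _ lt; exact: ltW.
  by rewrite lfB.
have : (interior (M f B') `&` @Z2 R) (f + a *: x).
  by split=> //; apply: interior_ray Ma' _ lt; exact: ltW.
by rewrite lfB'.
Qed.

Definition ray_key (g : 'rV[R]_k) (j1 j2 j3 : 'I_k) :=
  exists B u e1 e2 p q,
  [/\ chart f B 0 1 Defs.i3 u e1 e2 p q,
      lattice_free (M f B) /\ g = gamma r B,
      0 < psi B (r j1) /\ u = f + (psi B (r j1))^-1 *: r j1,
      0 < psi B (r j2) /\ u + 2 *: e1 = f + (psi B (r j2))^-1 *: r j2 &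
      1 < dot q (f - u) \/
      0 < psi B (r j3) /\ 1 < dot q (f + (psi B (r j3))^-1 *: r j3 - u)].

Lemma Xi1_ray_key g : Xi1 f r g -> exists j1 j2 j3, ray_key g j1 j2 j3.
Proof.
move=> [B [t1 [p1 [p2 [p12 [[v1 F1] [j1 [pj1 p1E]]] [[v2 F2] [j2 [pj2 p2E]]]]]]
  [S [SS out]] ->]].
have [V lab] := type1_labelled t1.
have un : uniq [:: 0; 1; Defs.i3] by [].
have [p [q ch]] := labelled_chart lab un.
set u := V 0 in ch; set e1 := _ *: _ in ch; set e2 := 2^-1 *: (V Defs.i3 - u) in ch.
have SE := Sigma3_chart ch un SS.
have lf : lattice_free (M f B) by case: lab.
have [j3 out3] : exists j3, 1 < dot q (f - u) \/
    0 < psi B (r j3) /\ 1 < dot q (f + (psi B (r j3))^-1 *: r j3 - u).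
  case: out => [nSf|[_ /existsNP [x /not_implyP [[j3 [pj3 xE]] nSx]]]].
    exists j1; left; rewrite ltNge; apply/negP => le1; apply: nSf; apply/SE.
    by rewrite le1 andbT ltW // (chart_f2 ch).
  exists j3; right; split=> //; rewrite -xE ltNge; apply/negP => le1.
  apply: nSx; apply/SE; rewrite le1 andbT.
  have Mx : M f B x by rewrite xE; exact: ray_intersection_M.
  by have [_ _ ->] := (chart_M ch un x).1 Mx.
have := (facet3_vertex ch un v1 F1, facet3_vertex ch un v2 F2).
move=> [[e|e] [e'|e']]; rewrite e e' ?eqxx // in p12 p1E p2E.
  by exists j1, j2, j3, B, u, e1, e2, p, q; split.
by exists j2, j1, j3, B, u, e1, e2, p, q; split.
Qed.

Lemma ray_key_inj g g' j1 j2 j3 : ray_key g j1 j2 j3 -> ray_key g' j1 j2 j3 -> g = g'.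
Proof.
move=> [B [u [e1 [e2 [p [q [ch [lf ->] [pj1 uE] [pj2 vE] out]]]]]]].
move=> [B' [u' [e1' [e2' [p' [q' [ch' [lf' ->] [pj1' uE'] [pj2' vE'] out']]]]]]].
have un : uniq [:: 0; 1; Defs.i3] by [].
have Zu := chart_Z2_origin ch; have Zu' := chart_Z2_origin ch'.
have Z2int : (2 : R) \is a Num.int by rewrite -[2]/(2%:R) natr_int.
have Zv : Z2 (u + 2 *: e1) by apply: Z2D => //; apply: Z2Z => //; exact: chart_Z2_e1 ch.
have Zv' : Z2 (u' + 2 *: e1') by apply: Z2D => //; apply: Z2Z => //; exact: chart_Z2_e1 ch'.
have uu' : u = u'.
  rewrite uE in Zu; rewrite uE' in Zu'; rewrite uE uE'; congr (_ + _ *: _).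
  by apply: (lattice_on_ray lf lf' _ _ _ _ Zu Zu'); rewrite ?invr_gt0 //;
    apply: ray_intersection_M.
have e11' : e1 = e1'.
  have : u + 2 *: e1 = u' + 2 *: e1'.
    rewrite vE in Zv; rewrite vE' in Zv'; rewrite vE vE'; congr (_ + _ *: _).
    by apply: (lattice_on_ray lf lf' _ _ _ _ Zv Zv'); rewrite ?invr_gt0 //;
      apply: ray_intersection_M.
  by rewrite uu' => /addrI /scalerI; apply; apply/eqP; lra.
clear uE vE uE' vE' Zv Zv' Zu Zu' pj1 pj2 pj1' pj2'.
subst u' e1'.
pose a := dot p e2'; pose b := dot q e2'.
have [aZ bZ] : a \is a Num.int /\ b \is a Num.int.
  have := chart_Z2 ch (Z2D (chart_Z2_origin ch) (chart_Z2_e2 ch')).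
  by rewrite addrAC subrr add0r.
have b'Z : dot q' e2 \is a Num.int.
  have [_] := chart_Z2 ch' (Z2D (chart_Z2_origin ch) (chart_Z2_e2 ch)).
  by rewrite addrAC subrr add0r.
have dec x := dual_decomposition x (dual11 ch') (dual12 ch') (dual21 ch') (dual22 ch').
have qE x : dot q x = dot q' x * b.
  by rewrite {1}(dec x) !dotr (dual21 ch) mulr0 add0r.
have pE x : dot p x = dot p' x + dot q' x * a.
  by rewrite {1}(dec x) !dotr (dual11 ch) mulr1.
have b1 : b = 1.
  have bb' : b * dot q' e2 = 1 by rewrite mulrC -qE (dual22 ch).
  have := chart_f2 ch; have := chart_f2 ch'; rewrite qE => tf' tf.
  by have := int_mul_eq1 bZ b'Z bb'; case=> // b1; move: tf; rewrite b1; lra.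
have tE x : dot q x = dot q' x by rewrite qE b1 mulr1.
have sE x : dot p' x = dot p x - dot q x * a by rewrite pE tE; ring.
have [[f1 f2] f3] := (chart_f1 ch, chart_f2 ch, chart_f3 ch).
have [[f1' f2'] f3'] := (chart_f1 ch', chart_f2 ch', chart_f3 ch').
rewrite -!tE !sE in f1' f2' f3'.
have a_eq0 : a = 0.
  have [tf1|tf1] := ltP 1 (dot q (f - u)).
    apply: int_eq0 => //.
      rewrite ltNge; apply/negP => a1.
      have : 0 <= dot q (f - u) * (-1 - a) by rewrite mulr_ge0 //; lra.
      lra.
    rewrite ltNge; apply/negP => a1.
    have : 0 <= dot q (f - u) * (a - 1) by rewrite mulr_ge0 //; lra.
    lra.
  have [|[pj3 x3]] := out; first by lra.
  have [|[pj3' x3']] := out'; first by rewrite -tE; lra.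
  rewrite -tE in x3'.
  pose d := dot q (r j3).
  have tray c : dot q (f + c *: r j3 - u) = dot q (f - u) + c * d by rewrite !dotr /d; ring.
  rewrite !tray in x3 x3'.
  have d0 : 0 < d.
    have : 0 < (psi B (r j3))^-1 * d by lra.
    by rewrite pmulr_rgt0 // invr_gt0.
  pose c := (1 - dot q (f - u)) / d.
  have c0 : 0 <= c by rewrite divr_ge0 //; lra.
  have cd : c * d = 1 - dot q (f - u) by rewrite divfK // gt_eqF.
  have lt_c e : 1 < dot q (f - u) + e * d -> c < e.
    by move=> h; rewrite -(ltr_pM2r d0) cd; lra.
  have ty : dot q (f + c *: r j3 - u) = 1 by rewrite tray cd; ring.
  have := interior_ray (ray_intersection_M f pj3) c0 (lt_c _ x3).
  move=> /(chart_interior ch un) []; rewrite ty => s1 s0 _.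
  have := interior_ray (ray_intersection_M f pj3') c0 (lt_c _ x3').
  move=> /(chart_interior ch' un) []; rewrite -!tE !sE ty => s1' s0' _.
  by apply: int_eq0 => //; lra.
have slackE i x : slack f B i x = slack f B' i x.
  case: (ord3_cases i un) => ->.
  - by rewrite (chart_slack1 ch) (chart_slack1 ch') -!tE !sE a_eq0 !mulr0 !subr0.
  - by rewrite (chart_slack2 ch) (chart_slack2 ch') !sE a_eq0 !mulr0 !subr0.
  - by rewrite (chart_slack3 ch) (chart_slack3 ch') -!tE.
have rowdotE' i x : rowdot B i x = rowdot B' i x.
  by have := slackE i (f + 1 *: x); rewrite !slack_ray !mul1r; lra.
apply/rowP => j; rewrite !mxE; apply: psi_eq => [i|].
  by rewrite rowdotE' rowdot_le_psi.
by have [i ->] := psi_attained B' (r j); exists i; rewrite rowdotE'.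
Qed.

Lemma Xi1_finite_card : finite_set (Xi1 f r) /\ (#|` fset_set (Xi1 f r)| <= k ^ 3)%N.
Proof.
pose h (j : 'I_k * 'I_k * 'I_k) := xget 0 [set g | ray_key g j.1.1 j.1.2 j.2].
have sub : Xi1 f r `<=` h @` setT.
  move=> g /Xi1_ray_key [j1 [j2 [j3 key]]]; exists (j1, j2, j3) => //.
  rewrite /h; apply: ray_key_inj (key).
  by apply: (@xgetPex _ 0 [set g | ray_key g j1 j2 j3]); exists g.
have fin : finite_set (h @` setT) by apply: finite_image; exact: finite_finset.
split; first exact: sub_finite_set sub fin.
have le1 : (#|` fset_set (Xi1 f r)| <= #|` fset_set (h @` setT)|)%N.
  apply: fsubset_leq_card; rewrite -fset_set_sub //; exact: sub_finite_set sub fin.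
apply: leq_trans le1 _; rewrite fset_set_image; last exact: finite_finset.
apply: leq_trans (leq_imfset_card _ _ _) _.
have -> : (k ^ 3 = size (enum {: 'I_k * 'I_k * 'I_k}))%N.
  by rewrite -cardE !card_prod !card_ord !expnS expn0 muln1 mulnA.
by apply: uniq_leq_size => [|j _]; [exact: enum_finmem_uniq|rewrite mem_enum].
Qed.
End Counting.

Lemma leq_encoding_size k (fQ : 'rV[rat]_2) (rQ : 'I_k -> 'rV[rat]_2) :
  (k <= encoding_size fQ rQ)%N.
Proof.
rewrite /encoding_size -{1}[k]card_ord -sum1_card.
apply: leq_trans (leq_addl _ _); apply: leq_sum => j _.
by rewrite /size_rV addSn.
Qed.

Theorem proposition3p15 (R : realType) :
  exists p : {poly nat},
  forall (k : nat) (fQ : 'rV[rat]_2) (rQ : 'I_k -> 'rV[rat]_2),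
  let f : 'rV[R]_2 := map_mx ratr fQ in
  let r : 'I_k -> 'rV[R]_2 := fun j => map_mx ratr (rQ j) in
  let Xi := Xi1 f r in
  [/\ Xi `<=` Delta1 f r,
      finite_set Xi,
      (forall g : 'rV[R]_k,
        (Delta1 f r `\` (Xi `|` Pi f r `|` Delta2 f r)) g ->
        (exists g1 g2 : 'rV[R]_k,
           [/\ Delta f r g1, Delta f r g2 &
               strict_convex_combination g g1 g2]) \/
        (exists g' : 'rV[R]_k, Delta f r g' /\ dominated g g')) &
      (#|` fset_set Xi | <= p.[encoding_size fQ rQ])%N].
Proof.
exists ('X^3) => k fQ rQ f r Xi; have [fin card] := Xi1_finite_card f r; split=> //.
- by move=> g [B [t1 _ _ ->]]; exists B.
- move=> g [[B [t1 ->]] notin]; apply: type1_dichotomy => // h; apply: notin.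
    by left; left.
  by right.
- apply: leq_trans card _; rewrite hornerXn.
  suff -> : (encoding_size fQ rQ ^+ 3)%R = (encoding_size fQ rQ ^ 3)%N.
    by rewrite leq_exp2r // leq_encoding_size.
  by rewrite !expnS expn0 muln1.
Qed.
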